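(* The following statements are equivalent: (a) $\mathrm{MA}_{\mathfrak c}(\mathcal P(\omega)/\mathrm{fin})$; (b) for every MAD family $\mathcal A$ (on $\omega$), the Vietoris hyperspace $\exp(\Psi(\mathcal A))$ is pseudocompact; (c) $\mathfrak h=\mathfrak c$ and every base tree has a cofinal branch; (d) $n(\omega^* )>\mathfrak c$.
   Context: $\mathfrak c=2^{\aleph_0}$. $[\omega]^\omega$ is the set of infinite subsets of $\omega$; $A\subseteq^* B$ means $A\setminus B$ is finite. An infinite family $\mathcal A\subseteq[\omega]^\omega$ is almost disjoint (AD) if any two distinct members have finite intersection; it is MAD if it is AD and not properly contained in any other AD family. For an AD family $\mathcal A$, the Mrówka–Isbell space $\Psi(\mathcal A)$ is the set $\omega\cup\mathcal A$ where the points of $\omega$ are isolated and a neighborhood base at $A\in\mathcal A$ is $\{\{A\}\cup(A\setminus F): F\subseteq\omega \text{ finite}\}$. For a topological space $X$, $\exp(X)$ is the set of nonempty closed subsets of $X$ with the Vietoris topology, generated by the sets $U^-=\{F\in\exp(X):F\cap U\ne\emptyset\}$ and $U^+=\{F\in\exp(X):F\subseteq U\}$ for $U\subseteq X$ open. A space is pseudocompact if every continuous real-valued function on it is bounded. For a cardinal $\kappa$ and a pre-order $P$, $\mathrm{MA}_\kappa(P)$ says: for every collection of at most $\kappa$ dense subsets of $P$ there is a filter on $P$ meeting every dense set of the collection. $\mathcal P(\omega)/\mathrm{fin}$ is regarded here as the pre-order $([\omega]^\omega,\subseteq^* )$. A collection $\mathcal D\subseteq[\omega]^\omega$ is open dense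 if every $A\in[\omega]^\omega$ has a subset $B\in\mathcal D$, and whenever $A\in[\omega]^\omega$, $B\in\mathcal D$ and $A\subseteq^*B$ then $A\in\mathcal D$. The distributivity number $\mathfrak h$ is the least cardinality of a family of open dense subsets of $[\omega]^\omega$ with empty intersection. A base tree is a tree $\mathcal T\subseteq[\omega]^\omega$ of height $\mathfrak h$, ordered by $\supseteq^*$, such that every element has $\mathfrak c$ many immediate successors, each level is a MAD family, and every infinite subset of $\omega$ has a subset belonging to $\mathcal T$. A cofinal branch is a branch meeting every level of the tree. $\omega^*=\beta\omega\setminus\omega$ is the space of free ultrafilters on $\omega$. For a $T_1$ space $X$ without isolated points, the Baire number $n(X)$ is the smallest cardinality of a family of open dense subsets of $X$ with empty intersection. *)

(* Defs.v *)
From HB Require Import structures.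
From mathcomp Require Import all_boot all_order all_algebra.
From mathcomp Require Import all_classical all_reals all_analysis.
From mathcomp Require Import wochoice.
Import numFieldNormedType.Exports.

Set Implicit Arguments.
Unset Strict Implicit.
Unset Printing Implicit Defensive.

Local Open Scope classical_set_scope.
Local Open Scope card_scope.

Definition continuum : set (set nat) := [set: set nat].

(* Cardinals are represented by sets up to [#=]: [K] has the least cardinality *)
(* among the members of [P].                                                  *)
Definition least_card (T : Type) (P : set (set T)) (U : Type) (K : set U) :=
  (exists2 D, P D & D #= K) /\ (forall D, P D -> K #<= D).

Definition infinite_subsets : set (set nat) := [set A | infinite_set A].

Definition almost_subset (A B : set nat) := finite_set (A `\` B).

Definition almost_disjoint (A : set (set nat)) :=
  [/\ infinite_set A,
      A `<=` infinite_subsets &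
      forall a b, A a -> A b -> a <> b -> finite_set (a `&` b)].

Definition mad (A : set (set nat)) :=
  almost_disjoint A /\
  forall B, almost_disjoint B -> A `<=` B -> B = A.

(* [le] is a pre-order on [P]; [le p q] reads: [p] is stronger than [q]. *)

Section MartinAxiom.
Context (T : Type) (P : set T) (le : T -> T -> Prop).

Definition forcing_dense (D : set T) :=
  D `<=` P /\ forall p, P p -> exists2 d, D d & le d p.

Definition forcing_filter (G : set T) :=
  [/\ G `<=` P, G !=set0,
      (forall p q, G p -> P q -> le p q -> G q) &
      (forall p q, G p -> G q -> exists r, [/\ G r, le r p & le r q])].

Definition MA (U : Type) (kappa : set U) :=
  forall F : set (set T),
    F #<= kappa -> (forall D, F D -> forcing_dense D) ->
    exists2 G, forcing_filter G & forall D, F D -> G `&` D !=set0.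

End MartinAxiom.

Definition open_dense (D : set (set nat)) :=
  [/\ D `<=` infinite_subsets,
      (forall A, infinite_set A -> exists2 B, B `<=` A & D B) &
      (forall A B, infinite_set A -> D B -> almost_subset A B -> D A)].

Definition is_distributivity_number (U : Type) (K : set U) :=
  least_card
    [set F : set (set (set nat)) |
      (forall D, F D -> open_dense D) /\ \bigcap_(D in F) D = set0] K.

(* Trees are subsets [S] of [T] ordered by the restriction of [R]. *)

Section Trees.
Context (T : Type) (S : set T) (R : rel T).

Definition strict_preds (t : T) := [set s | [/\ S s, R s t & s <> t]].

Definition tree :=
  [/\ reflexive R, transitive R, {in S &, antisymmetric R} &
      forall t, S t -> wo_chain R (mem (strict_preds t))].

Definition immediate_succs (t : T) :=
  [set s | [/\ S s, strict_preds s t &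
    forall r, strict_preds s r -> ~ (R t r /\ t <> r)]].

Definition branch (B : set T) :=
  [/\ B `<=` S, chain R (mem B) &
      forall C, C `<=` S -> chain R (mem C) -> B `<=` C -> C = B].

End Trees.

Definition order_iso (T U : Type) (A : set T) (R : rel T)
    (B : set U) (Q : rel U) :=
  exists2 f : T -> U, set_bij A B f &
    {in A &, {mono f : x y / R x y >-> Q x y}}.

(* Ordinals are represented by well-ordered types [(K, Q)]; the ordinals below *)
(* it by the elements of [K], each standing for the type of its strict initial *)
(* segment.                                                                   *)
Definition level (T : Type) (S : set T) (R : rel T) (K : Type) (Q : rel K)
    (a : K) :=
  [set t | S t /\ order_iso (strict_preds S R t) R (strict_preds setT Q a) Q].

Definition has_height (T : Type) (S : set T) (R : rel T)
    (K : Type) (Q : rel K) :=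
  (forall t, S t -> exists a, level S R Q a t) /\
  (forall a, level S R Q a !=set0).

Definition initial_ordinal (K : Type) (Q : rel K) :=
  well_order Q /\ forall a, ~~ ([set: K] #<= strict_preds setT Q a).

Definition is_distributivity_ordinal (K : Type) (Q : rel K) :=
  initial_ordinal Q /\ is_distributivity_number [set: K].

Definition almost_supset : rel (set nat) := fun A B => `[< almost_subset B A >].

(* Each level is MAD, hence infinite, including the bottom one;
   [(K, Q)] is meant to be the ordinal [h]. *)
Definition base_tree (K : Type) (Q : rel K) (S : set (set nat)) :=
  [/\ S `<=` infinite_subsets,
      tree S almost_supset,
      has_height S almost_supset Q &
      [/\ (forall t, S t -> immediate_succs S almost_supset t #= continuum),
          (forall a, mad (level S almost_supset Q a)) &
          (forall A, infinite_set A -> exists2 B, B `<=` A & S B)]].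

Definition cofinal_branch (K : Type) (Q : rel K) (S B : set (set nat)) :=
  branch S almost_supset B /\
  forall a, B `&` level S almost_supset Q a !=set0.

Definition Psi (A : set (set nat)) : Type := (nat + set_type A)%type.

HB.instance Definition _ A := Choice.on (Psi A).

Section PsiTopology.
Context (A : set (set nat)).

Definition Psi_basic (a : set_type A) (F : set nat) : set (Psi A) :=
  inr a |` (inl @` (\val a `\` F)).

Definition Psi_nbhs (x : Psi A) : set_system (Psi A) :=
  match x with
  | inl n => [set U | U (inl n)]
  | inr a => [set U | exists2 F, finite_set F & Psi_basic a F `<=` U]
  end.

HB.instance Definition _ := hasNbhs.Build (Psi A) Psi_nbhs.

Let Psi_nbhs_filter (x : Psi A) : ProperFilter (nbhs x).
Proof.
case: x => [n|a]; apply: Build_ProperFilter_ex.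
- by move=> P Pn; exists (inl n).
- by split=> [|P Q Pn Qn|P Q PQ Pn] //; apply: PQ.
- by move=> P [F _ FP]; exists (inr a); apply: FP; left.
- split=> [|P Q [F finF FP] [G finG GQ]|P Q PQ [F finF FP]].
  + by exists set0.
  + exists (F `|` G); first by rewrite finite_setU.
    move=> y [->|[n [an nFG] <-]].
      by split; [apply: FP|apply: GQ]; left.
    by split; [apply: FP|apply: GQ]; right; exists n => //;
      split=> // h; apply: nFG; [left|right].
  + by exists F => //; apply: subset_trans PQ.
Qed.

Let Psi_nbhs_singleton (x : Psi A) (U : set (Psi A)) : nbhs x U -> U x.
Proof. by case: x => [n|a] // [F _]; apply; left. Qed.

Let Psi_nbhs_nbhs (x : Psi A) (U : set (Psi A)) :
  nbhs x U -> nbhs x (nbhs^~ U).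
Proof.
case: x => [n|a] // [F finF FU]; exists F => // y [->|[n an <-]].
  by exists F.
by apply: FU; right; exists n.
Qed.

HB.instance Definition _ := Nbhs_isNbhsTopological.Build (Psi A)
  Psi_nbhs_filter Psi_nbhs_singleton Psi_nbhs_nbhs.

End PsiTopology.

Definition hyperspace (X : topologicalType) : Type :=
  set_type [set F : set X | closed F /\ F !=set0].

HB.instance Definition _ X := Choice.on (hyperspace X).

Section Vietoris.
Context (X : topologicalType).

Definition vietoris_minus (U : set X) : set (hyperspace X) :=
  [set F | \val F `&` U !=set0].

Definition vietoris_plus (U : set X) : set (hyperspace X) :=
  [set F | \val F `<=` U].

Definition vietoris_subbase : set (set (hyperspace X)) :=
  [set vietoris_minus U | U in open] `|` [set vietoris_plus U | U in open].

HB.instance Definition _ :=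
  isSubBaseTopological.Build (hyperspace X) vietoris_subbase id.

End Vietoris.

Definition pseudocompact (R : realType) (X : topologicalType) :=
  forall f : X -> R, continuous f -> bounded_fun f.

Definition omega_star : Type :=
  set_type [set p : set_system nat |
    UltraFilter p /\ \bigcap_(A in p) A = set0].

HB.instance Definition _ := Choice.on omega_star.

Definition omega_star_basic (A : set nat) : set omega_star :=
  [set p | (\val p : set_system nat) A].

Lemma omega_star_ultra (p : omega_star) : UltraFilter (\val p : set_system nat).
Proof. by have /set_mem[] := valP p. Qed.

Lemma omega_star_cover : \bigcup_(A in setT) omega_star_basic A = setT.
Proof.
apply/seteqP; split=> // p _; exists setT => //=.
have ? := omega_star_ultra p; exact: filterT.
Qed.

Lemma omega_star_join (A B : set nat) (p : omega_star) :
  setT A -> setT B -> omega_star_basic A p -> omega_star_basic B p ->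
  exists C, [/\ setT C, omega_star_basic C p &
    omega_star_basic C `<=` omega_star_basic A `&` omega_star_basic B].
Proof.
move=> _ _ pA pB; have ? := omega_star_ultra p.
exists (A `&` B); split=> //; first exact: filterI.
move=> q qAB; have ? := omega_star_ultra q.
by split; apply: filterS qAB => n [].
Qed.

HB.instance Definition _ :=
  isBaseTopological.Build omega_star omega_star_cover omega_star_join.

Definition is_baire_number (X : topologicalType) (U : Type) (K : set U) :=
  least_card
    [set F : set (set X) |
      (forall D, F D -> open D /\ dense D) /\ \bigcap_(D in F) D = set0] K.

(* Main.v *)
(* Everything is compared with (a).                                           *)
(* (a) <-> (d): a free ultrafilter is a filter on the pre-order, a filter on  *)
(* the pre-order extends to a free ultrafilter, and dense sets on one side    *)
(* give dense open sets on the other.                                         *)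
(* (a) -> (b): a generic ultrafilter p on the indices makes every selector of *)
(* a sequence of finite sets converge in Psi(A) along p, so the sequence has  *)
(* a p-limit in exp(Psi(A)), whose finite subsets of omega are dense.         *)
(* (b) -> (a): identify omega with the binary tree, and let a MAD family trace *)
(* on the branch x a maximal almost disjoint subfamily of the x-th dense set, *)
(* copied along the branch. An accumulation point of the sequence of levels   *)
(* picks a member of every such copy, and these generate the filter.          *)
(* (a) -> (c): a filter meeting the (dense) levels of a base tree traces a    *)
(* cofinal branch. If h < c, a refining matrix of h MAD families could be     *)
(* labelled by reals so that every label is dense below every set, and a      *)
(* filter meeting all labels would map the h levels onto c.                   *)
(* (c) -> (a): when h = c the levels of a base tree can be chosen one by one  *)
(* inside c given open dense sets; a cofinal branch generates the filter.     *)

Require Import Defs.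
From mathcomp Require Import all_boot all_order all_algebra.
From mathcomp Require Import all_classical all_reals all_analysis.
From mathcomp Require Import wochoice zify lra.

Set Implicit Arguments.
Unset Strict Implicit.
Unset Printing Implicit Defensive.

Import Order.TTheory GRing.Theory Num.Theory numFieldNormedType.Exports.

Local Open Scope classical_set_scope.
Local Open Scope card_scope.

(** * Cardinals and well-orders *)

(** Statement (a) is the hub to which the other three are tied.

    A filter on infinite sets modulo finite generates a proper filter containing the cofinite sets,
    which extends to a free ultrafilter ([extend_to_omega_star]), and a free ultrafilter is itself
    such a filter. Dense families and dense open sets of [omega_star] translate into one another, so
    (a) and (d) both say that continuum many dense open sets have a common point.

    The distributivity number enters through refining matrices of MAD families
    ([exists_level_matrix]): fewer than h levels always have a common MAD refinement, so the
    construction runs through h stages. Under (a) a filter selects at most one member of each level;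
    if every infinite set is met by continuum many members of some level ([continuum_split]), the
    members can be labelled so that a generic filter sees every label, and h is at least c
    ([MA_distributivity]). Conversely, if h = c, there are enough levels to place one inside each of
    continuum many given dense sets; the matrix is a base tree, and a cofinal branch generates the
    required filter ([cofinal_branch_MA]).

    For hyperspaces, the nonempty finite subsets of omega are dense isolated points. Under (a) one
    ultrafilter makes every sequence of integers converge, so any sequence of such finite sets has a
    limit along it ([hyper_limit]) and no continuous function is unbounded. Conversely, a MAD family
    on the binary tree is built so that any accumulation point of the sequence of levels encodes a
    generic filter ([pseudocompact_MA]). *)

Lemma card_le_inj (T U : Type) (A : set T) (B : set U) (f : T -> U) :
  (forall x, A x -> B (f x)) ->
  (forall x y, A x -> A y -> f x = f y -> x = y) -> A #<= B.
Proof.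
move=> fAB finj; have /injfunPex[g] : exists2 f, set_fun A B f & set_inj A f.
  by exists f => // x y /set_mem Ax /set_mem Ay; apply: finj.
exact: inj_card_le.
Qed.

Lemma card_le_surj (T U : Type) (A : set T) (B : set U) (f : T -> U) :
  (forall y, B y -> exists2 x, A x & f x = y) -> B #<= A.
Proof.
by move=> fAB; apply: card_le_trans (card_image_le f A); apply: subset_card_le.
Qed.

Lemma card_le_injP (T U : Type) (u0 : U) (A : set T) (B : set U) :
  A #<= B -> exists f : T -> U, (forall x, A x -> B (f x)) /\
    (forall x y, A x -> A y -> f x = f y -> x = y).
Proof.
move=> /card_leP[f].
exists (fun x => if pselect (A x) is left h
  then val (f (SigSub (mem_set h))) else u0).
split=> [x Ax|x y Ax Ay]; first by case: pselect => // ?; exact: set_valP.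
case: pselect => // {}Ax; case: pselect => // {}Ay.
by move=> /val_inj /(inj (mem_set I) (mem_set I)) [].
Qed.

Lemma card_le_surjP (T U : Type) (t0 : T) (A : set T) (B : set U) :
  A t0 -> A #<= B -> exists f : U -> T, (forall y, A (f y)) /\
    (forall x, A x -> exists2 y, B y & f y = x).
Proof.
move=> At0 AB; case: (pselect (exists u : U, True)) => [[u0 _]|noU]; last first.
  by case/card_leP: AB => f; case: noU; exists (val (f (SigSub (mem_set At0)))).
have [g [gAB ginj]] := card_le_injP u0 AB.
have /choice[f fP] : forall y, exists x,
    A x /\ ((exists2 z, A z & g z = y) -> g x = y).
  move=> y; case: (pselect (exists2 z, A z & g z = y)) => [[z Az gz]|nz].
    by exists z.
  by exists t0.
exists f; split=> [y|x Ax]; first by case: (fP y).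
exists (g x); first exact: gAB.
by have [Af gf] := fP (g x); apply: ginj => //; apply: gf; exists x.
Qed.

(* Zorn on the sets of points of the product of the members of P on which every *)
(* projection is injective: some projection of a maximal one is onto.          *)
Lemma exists_least_card (T : Type) (P : set (set T)) :
  P !=set0 -> exists2 D, P D & forall E, P E -> D #<= E.
Proof.
move=> P0; pose good (M : set (set T -> T)) :=
  (forall m D, M m -> P D -> D (m D)) /\
  (forall m n D, M m -> M n -> P D -> m D = n D -> m = n).
have [|M [[Mval Minj] Mmax]] := @Zorn_bigcup _ good.
  move=> F FP Ftot; split=> [m D [M FM Mm] PD|m n D [M FM Mm] [N FN Nn] PD].
    by have [v _] := FP _ FM; exact: (v m D Mm PD).
  case: (Ftot _ _ FM FN) => sub.
    by have [_ v] := FP _ FN; apply: (v m n D) => //; apply: sub.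
  by have [_ v] := FP _ FM; apply: (v m n D) => //; apply: sub.
have [[D PD Dsurj]|nosurj] := pselect (exists2 D, P D &
    forall x, D x -> exists2 m, M m & m D = x).
  exists D => // E PE.
  apply: (card_le_trans (card_le_surj Dsurj)).
  apply: (@card_le_inj _ _ _ _ (fun m => m E)) => [m Mm|m n Mm Mn].
    exact: (Mval m E).
  exact: (Minj m n E).
have Pnew D : exists x, P D -> D x /\ forall m, M m -> m D <> x.
  have [PD|nPD] := pselect (P D); last first.
    have [E PE] := P0; have [x _] : exists x : T, True.
      apply: contrapT => nx; apply: nosurj; exists E => // x.
      by case: nx; exists x.
    by exists x.
  apply: contrapT => nex; apply: nosurj; exists D => // x Dx.
  apply: contrapT => nm; apply: nex; exists x => _; split=> // m Mm mx.
  by apply: nm; exists m.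
have [e eP] := choice Pnew.
exfalso; apply: (Mmax (M `|` [set e])).
  split; first by left.
  move=> /(_ e (or_intror erefl)) Me; have [E PE] := P0.
  by have [_ /(_ _ Me)] := eP E PE; apply.
split=> [m D [Mm|->] PD|m n D [Mm|->] [Mn|->] PD //].
- exact: (Mval m D).
- by have [] := eP D PD.
- exact: (Minj m n D).
- by have [_ /(_ _ Mm)] := eP D PD.
- by have [_ /(_ _ Mn) h] := eP D PD => /esym /h.
Qed.

(** Copies of both sets live in the sum type, where the least-cardinality principle applies to the
    pair of copies. *)
Lemma card_le_total (T U : Type) (A : set T) (B : set U) :
  A #<= B \/ B #<= A.
Proof.
pose A' : set (T + U) := inl @` A; pose B' : set (T + U) := inr @` B.
have AA' : A #<= A' /\ A' #<= A.
  split; last exact: card_image_le.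
  by apply: (@card_le_inj _ _ _ _ inl) => [x Ax|x y _ _ []//]; exists x.
have BB' : B #<= B' /\ B' #<= B.
  split; last exact: card_image_le.
  by apply: (@card_le_inj _ _ _ _ inr) => [x Ax|x y _ _ []//]; exists x.
have [|D [->|->] Dle] := @exists_least_card _ [set A'; B'].
- by exists A'; left.
- left; apply: card_le_trans AA'.1 (card_le_trans (Dle B' _) BB'.2).
  by right.
- right; apply: card_le_trans BB'.1 (card_le_trans (Dle A' _) AA'.2).
  by left.
Qed.

Section WellOrder.
Context (K : Type) (Q : rel K) (woQ : well_order Q).

Definition wlt (a b : K) := Q a b /\ a <> b.

Lemma wo_min (A : set K) : A !=set0 -> exists2 z, A z & forall x, A x -> Q z x.
Proof.
move=> [x Ax]; have [|z [[Az zmin] _]] := woQ (A := mem A).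
  by exists x; rewrite inE.
exists z; first by rewrite inE in Az.
by move=> y Ay; apply: zmin; rewrite inE.
Qed.

Lemma wo_refl a : Q a a.
Proof. by have [|z -> /(_ a)] := @wo_min [set a]; [exists a|apply]. Qed.

Lemma wo_anti a b : Q a b -> Q b a -> a = b.
Proof.
move=> ab ba; have [|z [_ zuniq]] := woQ (A := mem [set a; b]).
  by exists a; rewrite !inE; left.
have za : z = a.
  apply: zuniq; split; first by rewrite inE; left.
  by move=> x; rewrite inE => -[->|->] //; exact: wo_refl.
have zb : z = b.
  apply: zuniq; split; first by rewrite inE; right.
  by move=> x; rewrite inE => -[->|->] //; exact: wo_refl.
by rewrite -za zb.
Qed.

Lemma wo_total a b : Q a b \/ Q b a.
Proof.
have [|z [->|->] zmin] := @wo_min [set a; b]; first by exists a; left.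
- by left; apply: zmin; right.
- by right; apply: zmin; left.
Qed.

Lemma wo_trans a b c : Q a b -> Q b c -> Q a c.
Proof.
move=> ab bc; have [|z zE zmin] := @wo_min [set x | [\/ x = a, x = b | x = c]].
  by exists a; constructor 1.
case: zE zmin => -> zmin.
- by apply: zmin; constructor 3.
- by rewrite (wo_anti ab (zmin a _))//; constructor 1.
- by rewrite -(wo_anti bc (zmin b _))//; constructor 2.
Qed.

Lemma wlt_trans a b c : wlt a b -> wlt b c -> wlt a c.
Proof.
move=> [ab nab] [bc nbc]; split; first exact: wo_trans bc.
by move=> ac; apply: nab; apply: wo_anti => //; rewrite ac.
Qed.

Lemma wlt_irr a : ~ wlt a a. Proof. by case. Qed.

Lemma wlt_or a b : [\/ wlt a b, a = b | wlt b a].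
Proof.
have [->|ab] := pselect (a = b); first by constructor 2.
have [Qab|Qba] := wo_total a b; first by constructor 1.
by constructor 3; split=> // ba; exact: ab.
Qed.

Lemma not_wlt a b : ~ wlt a b -> Q b a.
Proof.
case: (wlt_or a b) => [//|-> _|[]//]; exact: wo_refl.
Qed.

Lemma wlt_wf : well_founded wlt.
Proof.
move=> a; apply: contrapT => na.
have [z nz zmin] := @wo_min [set a | ~ Acc wlt a] (ex_intro _ a na).
apply: nz; constructor => y yz; apply: contrapT => ny.
by case: (yz) => _; apply; apply: wo_anti (zmin _ ny); case: yz.
Qed.

End WellOrder.

(** Transfinite recursion with a choice at each stage. As [P a] looks at its function only below
    [a], the recursion may truncate the function there and fill in a default point elsewhere. *)
Lemma wf_choice (K : Type) (lt : K -> K -> Prop) (V : pointedType)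
    (P : K -> (K -> V) -> V -> Prop) :
  well_founded lt ->
  (forall a f g v, (forall b, lt b a -> f b = g b) -> P a f v -> P a g v) ->
  (forall a f, (forall b, lt b a -> P b f (f b)) -> exists v, P a f v) ->
  exists f, forall a, P a f (f a).
Proof.
move=> wf Ploc Pex.
pose restr a (rec : forall b, lt b a -> V) : K -> V := fun b =>
  if pselect (lt b a) is left h then rec b h else point.
pose step a (rec : forall b, lt b a -> V) : V :=
  xget point [set v | P a (restr a rec) v].
pose f := Fix wf (fun _ => V) step.
have fE a : f a = xget point [set v | P a (restr a (fun b _ => f b)) v].
  rewrite /f Fix_eq// => x g h gh; congr (step x _).
  apply: functional_extensionality_dep => b.
  by apply: functional_extensionality_dep => ?; exact: gh.
have restrE a b : lt b a -> restr a (fun b _ => f b) b = f b.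
  by move=> ba; rewrite /restr; case: pselect.
exists f; elim/(well_founded_ind wf) => a IH.
have [v Pv] := Pex a f IH; rewrite [f a in X in P _ _ X]fE.
apply: (Ploc _ (restr a (fun b _ => f b))) => [b /restrE//|].
apply: (@xgetPex _ point [set v | P a (restr a (fun b _ => f b)) v]).
by exists v; apply: Ploc Pv => b /restrE.
Qed.

Lemma exists_initial_ordinal (U : Type) (A : set U) :
  exists (K : Type) (Q : rel K), initial_ordinal Q /\ [set: K] #= A.
Proof.
pose T := {classic (set_type A)}.
have [R woR] := well_ordering_principle T.
have TA : [set: T] #= A by exact: card_setT.
have [[a0 a0P]|none] := pselect (exists a, [set: T] #<= strict_preds setT R a);
  last first.
  exists T, R; split=> //; split=> // a; apply/negP => Ta.
  by apply: none; exists a.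
(* Some proper segment is already as large as the whole order; the segment below the least such [a]
   is an initial ordinal of the same size. *)
have [a aP amin] := wo_min woR
  (ex_intro [set a | [set: T] #<= strict_preds setT R a] a0 a0P).
pose K := set_type (strict_preds setT R a); pose Q : rel K := relpre val R.
have KT : [set: K] #= [set: T].
  rewrite card_eq_le; apply/andP; split.
    by apply: (@card_le_inj _ _ _ _ val) => // x y _ _; exact: val_inj.
  by apply: card_le_trans aP _; have := card_setT (strict_preds setT R a);
    rewrite card_eq_le => /andP[].
exists K, Q; split; last exact: card_eq_trans KT TA.
split=> [|b].
  apply: antisymmetric_well_order => [x y /andP[xy yx]|B [x Bx]].
    by apply: val_inj; exact: wo_anti woR _ _ xy yx.
  have [|z [u Bu uz] zmin] := @wo_min _ _ woR (val @` [set` B]).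
    by exists (val x), x.
  exists u; split=> // y By; rewrite /Q/= uz.
  by apply: zmin; exists y.
apply/negP => Kb; have bP : strict_preds setT R a (val b) by exact: set_valP.
have : [set: T] #<= strict_preds setT R (val b).
  move: KT; rewrite card_eq_le => /andP[_ KT]; apply: card_le_trans KT _.
  apply: card_le_trans Kb _; apply: (@card_le_inj _ _ _ _ val).
    by move=> x [_ xb nxb]; split=> //; move=> /val_inj.
  by move=> x y _ _; exact: val_inj.
move=> /amin ab; case: bP => _ ba; apply; exact: wo_anti woR _ _ ba ab.
Qed.

Definition pair_code (x : set nat * set nat) : set nat :=
  [set n.*2 | n in x.1] `|` [set n.*2.+1 | n in x.2].

Lemma pair_code_inj : injective pair_code.
Proof.
have in1 x n : pair_code x n.*2 <-> x.1 n.
  split=> [[[m xm /double_inj <-]//|[m _ /(congr1 odd)]]|xn]; last by left; exists n.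
  by rewrite /= !odd_double.
have in2 x n : pair_code x n.*2.+1 <-> x.2 n.
  split=> [[[m _ /(congr1 odd)]|[m xm [/double_inj <-]]]|xn]//;
    last by right; exists n.
  by rewrite /= !odd_double.
move=> [x1 x2] [y1 y2] xy; congr pair; apply/seteqP; split=> n.
- by move=> /(in1 (x1, x2)); rewrite xy => /in1.
- by move=> /(in1 (y1, y2)); rewrite -xy => /in1.
- by move=> /(in2 (x1, x2)); rewrite xy => /in2.
- by move=> /(in2 (y1, y2)); rewrite -xy => /in2.
Qed.

Lemma card_continuum_prod : [set: set nat * set nat] #<= continuum.
Proof.
by apply: (@card_le_inj _ _ _ _ pair_code) => // x y _ _; exact: pair_code_inj.
Qed.

Lemma card_infinite_setD1 (T : Type) (A : set T) (a : T) :
  infinite_set A -> A #<= A `\ a.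
Proof.
move=> infA; have /infiniteP /(card_le_injP a)[f [fA finj]] : infinite_set (A `\ a).
  by apply: infinite_setD => //; exact: finite_set1.
have finj' m n : f m = f n -> m = n by exact: finj.
(* Hilbert's hotel: [a] goes to [f 0], each [f n] to [f n.+1], and the rest stays fixed. *)
pose g x := if pselect (x = a) is left _ then f 0%N else
  if pselect (exists n, f n = x) is left e then f (projT1 (cid e)).+1 else x.
apply: (@card_le_inj _ _ _ _ g) => [x Ax|x y Ax Ay].
  rewrite /g; case: pselect => [xa|xa]; first exact: fA.
  by case: pselect => [e|ne]; [exact: fA|split].
rewrite /g; case: (pselect (x = a)) => [xa|xa]; case: (pselect (y = a)) => [ya|ya].
- by rewrite xa ya.
- by case: pselect => [e /finj'//|ne fy]; case: ne; exists 0%N.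
- by case: pselect => [e /finj'//|ne fx]; case: ne; exists 0%N.
- case: pselect => [e|ne]; case: pselect => [e'|ne'] => //.
  + case: (cid e) => m /= <-; case: (cid e') => n /= <-.
    by move=> /finj' [->].
  + by move=> E; case: ne'; eexists; exact: E.
  + by move=> E; case: ne; eexists; exact: (esym E).
Qed.

(** * Almost disjoint families and open dense sets *)

Lemma infinite_natP (A : set nat) :
  infinite_set A <-> forall m, exists2 k, A k & (m <= k)%N.
Proof.
split=> [infA m|Aub /finite_seqP[s As]].
  apply: contrapT => nA; apply: infA; apply: sub_finite_set (finite_II m).
  by move=> k Ak /=; rewrite ltnNge; apply/negP => mk; apply: nA; exists k.
have [k] := Aub (\max_(i <- s) i).+1; rewrite As /= => ks.
by rewrite ltnNge (@leq_bigmax_seq _ s xpredT id k ks).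
Qed.

(** For infinite sets this is compatibility in the pre-order of almost inclusion. *)
Definition meets (A B : set nat) := infinite_set (A `&` B).

Lemma meetsC A B : meets A B -> meets B A.
Proof. by rewrite /meets setIC. Qed.

Lemma meetsxx A : infinite_set A -> meets A A.
Proof. by rewrite /meets setIid. Qed.

Lemma sub_almost A B : A `<=` B -> almost_subset A B.
Proof. by rewrite /almost_subset -setD_eq0 => ->; exact: finite_set0. Qed.

Lemma almost_refl A : almost_subset A A.
Proof. exact: sub_almost. Qed.

Lemma almost_trans A B C :
  almost_subset A B -> almost_subset B C -> almost_subset A C.
Proof.
move=> AB BC; have : finite_set (A `\` B `|` B `\` C) by rewrite finite_setU.
apply: sub_finite_set => n [An nC].
by have [Bn|nB] := pselect (B n); [right|left].
Qed.

Lemma almost_setI A B C :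
  almost_subset A B -> almost_subset A C -> almost_subset A (B `&` C).
Proof.
move=> AB AC; have : finite_set (A `\` B `|` A `\` C) by rewrite finite_setU.
apply: sub_finite_set => n [An nBC].
by have [Bn|nB] := pselect (B n); [right; split=> // Cn; exact: nBC|left].
Qed.

Lemma almost_infinite A B : almost_subset A B -> infinite_set A -> infinite_set B.
Proof.
move=> AB infA finB; apply: infA.
have : finite_set (A `\` B `|` B) by rewrite finite_setU.
apply: sub_finite_set => n An.
by have [Bn|nB] := pselect (B n); [right|left].
Qed.

Lemma almost_meets A A' B B' : almost_subset A A' -> almost_subset B B' ->
  meets A B -> meets A' B'.
Proof.
move=> AA' BB'; apply: almost_infinite; apply: almost_setI.
- by apply: almost_trans AA'; apply: sub_almost => n [].
- by apply: almost_trans BB'; apply: sub_almost => n [].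
Qed.

Lemma common_meets X A B : infinite_set X ->
  almost_subset X A -> almost_subset X B -> meets A B.
Proof. by move=> /meetsxx Xinf XA XB; exact: almost_meets XA XB Xinf. Qed.

Lemma meets_subr X A B : A `<=` B -> meets X A -> meets X B.
Proof. by move=> /sub_almost; exact: almost_meets (almost_refl X). Qed.

Lemma enum_infinite (X : set nat) : infinite_set X ->
  exists2 e : nat -> nat, injective e & range e = X.
Proof.
move=> infX; have := eq_card_nat (countableP X) infX.
rewrite card_eq_sym => /pcard_eqP/bijPex[e [eX einj esurj]]; exists e.
  by move=> m n; apply: einj; rewrite inE.
apply/seteqP; split=> [_ [n _ <-]|k /esurj[n _ <-]]; first exact: eX.
by exists n.
Qed.

Lemma infinite_image (e : nat -> nat) (X : set nat) :
  injective e -> infinite_set X -> infinite_set (e @` X).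
Proof.
move=> einj infX; rewrite (@eq_finite_set _ _ _ X)//.
by apply: inj_card_eq => m n _ _; exact: einj.
Qed.

Lemma meets_image (e : nat -> nat) (X Y : set nat) : injective e ->
  meets (e @` X) (e @` Y) -> meets X Y.
Proof.
move=> einj infXY finXY; apply: infXY; apply: sub_finite_set (finite_image e finXY).
by move=> _ [[m Xm <-] [n Yn /einj nm]]; exists m => //; split; rewrite // -nm.
Qed.

Lemma infinite_split (X : set nat) : infinite_set X ->
  exists Y, [/\ Y `<=` X, infinite_set Y & infinite_set (X `\` Y)].
Proof.
move=> /enum_infinite[e einj <-]; exists (e @` [set n.*2 | n in setT]); split.
- by move=> _ [n _ <-]; exists n.
- apply: infinite_image => //; apply: infinite_image infinite_nat.
  exact: double_inj.
- have : infinite_set (e @` [set n.*2.+1 | n in setT]).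
    apply: infinite_image => //; apply: infinite_image infinite_nat.
    by move=> m n [] /double_inj.
  apply: sub_infinite_set => _ [_ [n _ <-] <-]; split; first by exists n.*2.+1.
  move=> [_ [m _ <-] /einj /(congr1 odd)].
  by rewrite /= !odd_double.
Qed.

(** Choose increasing points [z n] in [Y n]; all but the first [n] of them lie in [Y n]. *)
Lemma pseudointersection (Y : nat -> set nat) :
  (forall n, infinite_set (Y n)) -> (forall n, Y n.+1 `<=` Y n) ->
  exists Z, [/\ infinite_set Z, Z `<=` Y 0%N & forall n, almost_subset Z (Y n)].
Proof.
move=> Yinf Ydec.
have /choice[pick pickP] (nm : nat * nat) : exists k, Y nm.1 k /\ (nm.2 < k)%N.
  by have /infinite_natP/(_ nm.2.+1)[k Yk k_gt] := Yinf nm.1; exists k.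
pose z := fix z n := if n is n'.+1 then pick (n, z n') else pick (0, 0)%N.
have Yz n : Y n (z n).
  by case: n => [|n]; [have [] := pickP (0, 0)%N|have [] := pickP (n.+1, z n)].
have Yle m n : (m <= n)%N -> Y n `<=` Y m.
  elim: n => [|n IH]; first by rewrite leqn0 => /eqP->.
  rewrite leq_eqVlt => /orP[/eqP->//|/IH]; apply: subset_trans; exact: Ydec.
have zlt n : (z n < z n.+1)%N by have [] := pickP (n.+1, z n).
have zge n : (n <= z n)%N by elim: n => // n IH; apply: leq_ltn_trans (zlt n).
exists (range z); split.
- by apply/infinite_natP => m; exists (z m) => //; exists m.
- by move=> _ [n _ <-]; apply: (Yle 0%N n).
- move=> n; apply: sub_finite_set (finite_image z (finite_II n)).
  move=> _ [[m _ <-] nYz]; exists m => //=; rewrite ltnNge; apply/negP => nm.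
  by apply: nYz; apply: Yle nm _ _.
Qed.

(** Infinitude of the family is left out, so that the empty family and singletons can be starting
    points of [ad_extend]. *)
Definition ad_family (A : set (set nat)) := A `<=` infinite_subsets /\
  forall a b, A a -> A b -> meets a b -> a = b.

Definition hits_all (A : set (set nat)) :=
  forall X, infinite_set X -> exists2 a, A a & meets a X.

Lemma madP (A : set (set nat)) :
  mad A <-> [/\ infinite_set A, ad_family A & hits_all A].
Proof.
split=> [[[infA Ainf Aad] Amax]|[infA [Ainf Aad] Ahit]].
  have adA : ad_family A.
    by split=> // a b Aa Ab ab; apply: contrapT => /(Aad _ _ Aa Ab).
  split=> // X infX; apply: contrapT => nX.
  have nX' a : A a -> finite_set (a `&` X).
    by move=> Aa; apply: contrapT => aX; apply: nX; exists a.
  have AX : A X.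
    rewrite -(Amax (A `|` [set X])); first by right.
      split; first by rewrite finite_setU => -[].
        by move=> a [/Ainf|->].
      move=> a b [Aa|->] [Ab|->] ab //; first exact: Aad.
        exact: nX'.
      by rewrite setIC; exact: nX'.
    by move=> a; left.
  by apply: nX; exists X => //; exact: meetsxx.
split; first by split=> // a b Aa Ab ab; apply: contrapT => /(Aad _ _ Aa Ab).
move=> B [_ Binf Bad] AB; apply/seteqP; split=> // b Bb.
have [a Aa ab] := Ahit b (Binf _ Bb).
have [->//|nab] := pselect (b = a).
by case: ab; apply: Bad => //; [exact: AB|exact/nesym].
Qed.

Lemma ad_extend (D A0 : set (set nat)) :
  D `<=` infinite_subsets ->
  (forall X, infinite_set X -> exists2 B, B `<=` X & D B) ->
  A0 `<=` D -> ad_family A0 ->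
  exists M, [/\ A0 `<=` M, M `<=` D, ad_family M & hits_all M].
Proof.
move=> Dinf Ddense A0D [_ adA0].
(* [A0] is kept outside [M] so that the union of the empty chain is good. *)
pose good (M : set (set nat)) := M `<=` D /\
  forall a b, (A0 `|` M) a -> (A0 `|` M) b -> meets a b -> a = b.
have [|M [[MD adM] Mmax]] := @Zorn_bigcup _ good.
  move=> F Fgood Ftot; split=> [a [M FM Ma]|a b [A0a|[M FM Ma]] [A0b|[N FN Nb]]].
  - by have [MD _] := Fgood M FM; exact: MD.
  - exact: adA0.
  - by have [_ h] := Fgood N FN; apply: h; [left|right].
  - by have [_ h] := Fgood M FM; apply: h; [right|left].
  - case: (Ftot _ _ FM FN) => sub.
    + by have [_ h] := Fgood N FN; apply: h; right => //; exact: sub.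
    + by have [_ h] := Fgood M FM; apply: h; right => //; exact: sub.
exists (A0 `|` M); split.
- by move=> a; left.
- by move=> a [/A0D|/MD].
- by split=> // a [/A0D|/MD] /Dinf.
- move=> X infX; apply: contrapT => nX; have [B BX DB] := Ddense X infX.
  have nB a : (A0 `|` M) a -> ~ meets a B.
    by move=> Ma aB; apply: nX; exists a => //; exact: meets_subr aB.
  have nMB : ~ (A0 `|` M) B.
    by move=> /nB; apply; apply: meetsxx; exact: Dinf.
  apply: (Mmax (M `|` [set B])).
    split=> [a|/(_ B)]; first by left.
    by move=> /(_ (or_intror erefl)) MB; apply: nMB; right.
  split=> [a [/MD|->]//|a b]; rewrite setUA.
  move=> [Ma|->] [Mb|->] // ab; first exact: adM.
    by case: (nB a Ma).
  by case: (nB b Mb); exact: meetsC.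
Qed.

(* The [n]-th node of the branch [x] of the binary tree whose [n]-th level is *)
(* [2 ^ n, 2 ^ n.+1).                                                        *)
Fixpoint bnode (x : set nat) (n : nat) : nat :=
  if n is m.+1 then ((bnode x m).*2 + `[< x m >])%N else 1%N.

Lemma bnode_bounds x n : (2 ^ n <= bnode x n < 2 ^ n.+1)%N.
Proof.
elim: n => //= n; rewrite !expnS => /andP[lo hi]; apply/andP.
by case: `[< x n >]; split; lia.
Qed.

Lemma bnode_level x y m n : bnode x m = bnode y n -> m = n.
Proof.
move=> xy; have /andP[xlo xhi] := bnode_bounds x m.
have /andP[ylo yhi] := bnode_bounds y n.
apply/eqP; rewrite eqn_leq -ltnS -[(n <= m)%N]ltnS.
rewrite -(@ltn_exp2l 2)// -(@ltn_exp2l 2 n)//; apply/andP; split.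
  by apply: leq_ltn_trans yhi; rewrite -xy.
by apply: leq_ltn_trans xhi; rewrite xy.
Qed.

Lemma bnode_inj x : injective (bnode x).
Proof. by move=> m n /bnode_level. Qed.

Lemma bnode_agree x y n : bnode x n = bnode y n ->
  forall k, (k < n)%N -> x k <-> y k.
Proof.
elim: n => //= n IH xy k; rewrite ltnS leq_eqVlt => /orP[/eqP->|kn].
  have /(congr1 odd) := xy; rewrite !oddD !odd_double /= !oddb => xyn.
  by split=> /asboolP; [rewrite xyn|rewrite -xyn] => /asboolP.
apply: IH kn; have /(congr1 half) := xy.
by rewrite ![(_.*2 + _)%N]addnC !half_bit_double.
Qed.

Definition branch_set (x : set nat) := range (bnode x).

Lemma infinite_branch_set x : infinite_set (branch_set x).
Proof. by apply: infinite_image infinite_nat; exact: bnode_inj. Qed.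

Lemma branch_set_ad x y : meets (branch_set x) (branch_set y) -> x = y.
Proof.
move=> xy; apply/seteqP; suff h k : x k <-> y k by split=> k /h.
(* A common node of value at least [2 ^ k.+1] lies on a level beyond [k], hence determines the bit
   [k]. *)
have [_ [[n _ <-] [m _ mn]] kn] := (infinite_natP _).1 xy (2 ^ k.+1)%N.
have nm := bnode_level mn; rewrite nm in mn.
apply: iff_sym; apply: bnode_agree mn _ _.
have /andP[_ hi] := bnode_bounds x n.
by rewrite -ltnS -(@ltn_exp2l 2)//; apply: leq_ltn_trans hi.
Qed.

(** Distinct branches of the binary tree share only finitely many nodes, and an enumeration of [X]
    carries them into [X]. *)
Lemma continuum_ad_below (X : set nat) : infinite_set X ->
  exists c : set nat -> set nat, [/\ forall x, c x `<=` X,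
    forall x, infinite_set (c x) & forall x y, meets (c x) (c y) -> x = y].
Proof.
move=> /enum_infinite[e einj <-]; exists (fun x => e @` branch_set x); split.
- by move=> x _ [n _ <-]; exists n.
- by move=> x; apply: infinite_image => //; exact: infinite_branch_set.
- by move=> x y /(meets_image einj) /branch_set_ad.
Qed.

Lemma open_denseI D E : open_dense D -> open_dense E -> open_dense (D `&` E).
Proof.
move=> [Dinf Dd Do] [Einf Ed Eo]; split=> [B [/Dinf]//|A infA|A B infA [DB EB] AB].
  have [B BA DB] := Dd A infA; have [C CB EC] := Ed B (Dinf _ DB).
  exists C; first exact: subset_trans BA.
  by split=> //; apply: (Do _ B) => //; [exact: Einf|exact: sub_almost].
by split; [exact: Do AB|exact: Eo AB].
Qed.

(** The remainder is required to be infinite so that no set occurs on two levels of a matrix. *)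
Definition strictly_below (T : set (set nat)) := [set B | infinite_set B /\
  exists2 a, T a & almost_subset B a /\ infinite_set (a `\` B)].

Lemma open_dense_strictly_below T : hits_all T -> open_dense (strictly_below T).
Proof.
move=> Thit; split=> [B []//|A /Thit[a Ta aA]|A B infA [infB [a Ta [Ba aB]]] AB].
  have [Y [YaA infY aAY]] := infinite_split aA.
  exists Y; first by move=> n /YaA[].
  split=> //; exists a => //; split; first by apply: sub_almost => n /YaA[].
  by apply: sub_infinite_set aAY => n [[]].
split=> //; exists a => //; split; first exact: almost_trans Ba.
apply: almost_infinite aB; apply: sub_finite_set AB => n [[an nBn] naA].
by split=> //; apply: contrapT => nAn; exact: naA.
Qed.

Definition almost_closure (D : set (set nat)) := [set B | infinite_set B /\
  exists2 d, D d & almost_subset B d].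

Lemma open_dense_closure D : forcing_dense infinite_subsets almost_subset D ->
  open_dense (almost_closure D).
Proof.
move=> [Dinf Dd]; split=> [B []//|A infA|A B infA [infB [d Dd' Bd]] AB].
  have [d Dd' dA] := Dd A infA; exists (d `&` A); first by move=> n [].
  split; last by exists d => //; apply: sub_almost => n [].
  apply: almost_infinite (Dinf _ Dd'); apply: almost_setI => //.
  exact: almost_refl.
by split=> //; exists d => //; exact: almost_trans Bd.
Qed.

(** Homogeneity: an enumeration of [X] identifies the infinite subsets of [X] with those of omega,
    so a family without common member below [X] pulls back to one with empty intersection, and lower
    bounds on h apply below every set. *)
Lemma open_dense_transport (F : set (set (set nat))) (X : set nat) :
  infinite_set X -> (forall D, F D -> open_dense D) ->
  ~ (exists2 B, B `<=` X & infinite_set B /\ forall D, F D -> D B) ->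
  exists F', [/\ F' #<= F, forall D, F' D -> open_dense D &
    \bigcap_(D in F') D = set0].
Proof.
move=> infX Fod nB; have [e einj eX] := enum_infinite infX.
pose h (D : set (set nat)) := [set C | infinite_set C /\ D (e @` C)].
exists (h @` F); split; first exact: card_image_le.
  move=> _ [D /Fod[Dinf Dd Do] <-]; split=> [C []//|A infA|A B infA [infB DB] AB].
    have [B BA DB] := Dd _ (infinite_image einj infA).
    have eB : e @` (e @^-1` B) = B.
      apply/seteqP; split=> [_ [n Bn <-]//|k Bk].
      by have [n _ nk] := BA _ Bk; exists n => //=; rewrite nk.
    exists (e @^-1` B); first by move=> n /BA[m Am /einj <-].
    split; last by rewrite eB.
    by move=> /(finite_image e); rewrite eB; exact: Dinf.
  split=> //; apply: Do DB _; first exact: infinite_image.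
  apply: sub_finite_set (finite_image e AB) => _ [[n An <-] nB'].
  by exists n => //; split=> // Bn; apply: nB'; exists n.
apply/seteqP; split=> // C FC; apply: nB.
have [[D FD]|noF] := pselect (F !=set0); last first.
  by exists X => //; split=> // D FD; case: noF; exists D.
have hC D' : F D' -> h D' C by move=> FD'; apply: FC; exists D'.
exists (e @` C); first by rewrite -eX => _ [n _ <-]; exists n.
split=> [|D' /hC[]//]; apply: infinite_image => //.
by have [] := hC D FD.
Qed.

(** Descend through the [D n] one after the other and take a pseudo-intersection, which openness
    puts into all of them. *)
Lemma open_dense_countable (D : nat -> set (set nat)) (X : set nat) :
  (forall n, open_dense (D n)) -> infinite_set X ->
  exists2 B, infinite_set B /\ B `<=` X & forall n, D n B.
Proof.
move=> Dod infX.
have /choice[f fP] (nA : nat * set nat) : exists B,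
    infinite_set nA.2 -> B `<=` nA.2 /\ D nA.1 B.
  have [infA|] := pselect (infinite_set nA.2); last by exists set0.
  by have [_ /(_ _ infA)[B BA DB] _] := Dod nA.1; exists B.
pose Y := fix Y n := if n is m.+1 then f (n, Y m) else f (0%N, X).
have DY n : D n (Y n).
  elim: n => [|n DYn]; first by have [] := fP (0%N, X) infX.
  have infY : infinite_set (Y n) by have [Dinf _ _] := Dod n; exact: Dinf.
  by have [] := fP (n.+1, Y n) infY.
have infY n : infinite_set (Y n) by have [Dinf _ _] := Dod n; apply/Dinf/DY.
have [|Z [infZ ZY0 ZY]] := pseudointersection infY.
  by move=> n; have [] := fP (n.+1, Y n) (infY n).
exists Z; first by split=> //; apply: subset_trans ZY0 _; have [] := fP (0%N, X) infX.
by move=> n; have [_ _ Do] := Dod n; apply: Do (DY n) (ZY n).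
Qed.

(** * Refining matrices of MAD families *)

(** [D a] is the open dense set that level [a] must refine; [X a] is a set below which level [a]
    must have a member, so that a surjective [X] makes the union of the levels dense. The last
    clause will supply the immediate successors of a base tree. *)
Definition level_matrix (K : Type) (Q : rel K) (D : K -> set (set nat))
    (X : K -> set nat) (T : K -> set (set nat)) := forall a,
  [/\ mad (T a), T a `<=` D a, exists2 t, T a t & t `<=` X a,
    (forall b, wlt Q b a -> T a `<=` strictly_below (T b)) &
    (forall b s, wlt Q b a -> T b s ->
      continuum #<= [set t | T a t /\ almost_subset t s])].

(** Two rounds of [ad_extend]: a maximal [M] inside [D], then a maximal [N] containing continuum
    many almost disjoint pieces of each member of [M]. If members of [D] compatible with [s] are
    almost inside [s], some member of [M] lies below [s] together with its pieces. *)
Lemma refine_mad (D : set (set nat)) (X : set nat) :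
  open_dense D -> infinite_set X ->
  exists M : set (set nat), [/\ mad M, M `<=` D, exists2 t, M t & t `<=` X &
    forall s, (forall B, D B -> meets B s -> almost_subset B s) ->
      infinite_set s -> continuum #<= [set t | M t /\ almost_subset t s]].
Proof.
move=> [Dinf Dd Do] infX; have [B0 B0X DB0] := Dd X infX.
have [||||M [B0M MD [_ adM] Mhit]] := @ad_extend D [set B0] => //.
- by move=> _ ->.
- by split=> [_ -> |_ _ -> ->//]; exact: Dinf.
have Minf m : M m -> infinite_set m by move=> /MD /Dinf.
have /choice[c cP] m : exists c : set nat -> set nat, M m ->
    [/\ forall x, c x `<=` m, forall x, infinite_set (c x) &
      forall x y, meets (c x) (c y) -> x = y].
  have [/Minf /continuum_ad_below[c cP]|] := pselect (M m); first by exists c.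
  by exists (fun=> set0).
have cm m x : M m -> c m x `<=` m by move=> /cP[].
have cinf m x : M m -> infinite_set (c m x) by move=> /cP[].
have cinj m x y : M m -> meets (c m x) (c m y) -> x = y by move=> /cP[_ _]; apply.
pose D' := D `&` [set B | exists2 m, M m & almost_subset B m].
pose A0 := [set B | exists2 m, M m & exists x, B = c m x].
have A0inf : A0 `<=` infinite_subsets by move=> _ [m Mm [x ->]]; exact: cinf.
have [||||N [A0N ND' [Ninf adN] Nhit]] := @ad_extend D' A0.
- by move=> B [/Dinf].
- move=> Y /Mhit[m Mm mY]; have [B BmY DB] := Dd _ mY.
  exists B; first by move=> n /BmY[].
  split=> //; exists m => //; apply: sub_almost => n /BmY[mn _]; exact: mn.
- move=> _ [m Mm [x ->]]; split.
    by apply: (Do _ m); [exact: cinf|exact: MD|apply: sub_almost; exact: cm].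
  by exists m => //; apply: sub_almost; exact: cm.
- split=> // _ _ [m Mm [x ->]] [n Mn [y ->]] mn.
  have E : m = n.
    apply: adM => //; apply: almost_meets mn; apply: sub_almost; exact: cm.
  by move: mn; rewrite -E => /(cinj _ _ _ Mm) ->.
have MB0 : M B0 by exact: B0M.
exists N; split.
- apply/madP; split=> //; apply/infiniteP.
  apply: (@card_le_inj _ _ _ _ (fun n => c B0 [set n])) => [n _|m n _ _ mn].
    by apply: A0N; exists B0 => //; exists [set n].
  have : [set m] = [set n].
    by apply: (cinj B0) => //; rewrite mn; apply: meetsxx; exact: cinf.
  by move=> /(congr1 (fun A => A m)) /= E; rewrite -E.
- by move=> B /ND'[].
- exists (c B0 set0); last by apply: subset_trans B0X; exact: cm.
  by apply: A0N; exists B0 => //; exists set0.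
- move=> s Ds infs; have [m Mm ms] := Mhit s infs.
  have ms' : almost_subset m s by apply: Ds => //; exact: MD.
  apply: (@card_le_inj _ _ _ _ (c m)) => [x _|x y _ _ xy].
    split; first by apply: A0N; exists m => //; exists x.
    by apply: almost_trans ms'; apply: sub_almost; exact: cm.
  by apply: (cinj m) => //; rewrite xy; apply: meetsxx; exact: cinf.
Qed.

(** At stage [a] there are fewer than [K] earlier levels; as [K] is at most the distributivity
    number, the sets strictly below all of them are still open dense, and [refine_mad] applies. *)
Lemma exists_level_matrix (K : Type) (Q : rel K) (D : K -> set (set nat))
    (X : K -> set nat) :
  initial_ordinal Q ->
  (forall F : set (set (set nat)), (forall E, F E -> open_dense E) ->
    \bigcap_(E in F) E = set0 -> [set: K] #<= F) ->
  (forall a, open_dense (D a)) -> (forall a, infinite_set (X a)) ->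
  exists T, level_matrix Q D X T.
Proof.
move=> [woQ iniQ] Kle Dod Xinf.
have [||T TP] := @wf_choice K (wlt Q) (set (set nat)) (fun a f v =>
  [/\ mad v, v `<=` D a, exists2 t, v t & t `<=` X a,
    (forall b, wlt Q b a -> v `<=` strictly_below (f b)) &
    (forall b s, wlt Q b a -> f b s ->
      continuum #<= [set t | v t /\ almost_subset t s])]) (wlt_wf woQ).
- move=> a f g v fg [? ? ? vf fc]; split=> // [b ba|b s ba].
    by rewrite -(fg b ba); exact: vf.
  by rewrite -(fg b ba); exact: fc.
- move=> a f fP.
  have fmad b : wlt Q b a -> [/\ infinite_set (f b), ad_family (f b) & hits_all (f b)].
    by move=> /fP[/madP].
  pose D' := D a `&` [set B | infinite_set B /\ forall b, wlt Q b a ->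
    strictly_below (f b) B].
  have D'od : open_dense D'.
    apply: open_denseI => //; split=> [B []//|A infA|A B infA [infB Bb] AB]; last first.
      split=> // b ba; have [_ _ h] := fmad b ba.
      by have [_ _ Do] := open_dense_strictly_below h; apply: Do (Bb b ba) AB.
    apply: contrapT => nB.
    pose F := [set strictly_below (f b) | b in strict_preds setT Q a].
    (* Otherwise transport gives a family with empty intersection no larger than the segment below
       [a], and [K] would embed in that segment. *)
    have [||F' [F'F F'od F'0]] := @open_dense_transport F A infA.
    + move=> _ [b [_ ba nba] <-]; apply: open_dense_strictly_below.
      by have [] := fmad b (conj ba nba).
    + move=> [B BA [infB BF]]; apply: nB; exists B => //; split=> // b [ba nba].
      by apply: BF; exists b.
    apply: (negP (iniQ a)); apply: card_le_trans (Kle _ F'od F'0) _.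
    exact: card_le_trans F'F (card_image_le _ _).
  have [M [madM MD' MX Mc]] := refine_mad D'od (Xinf a).
  exists M; split=> // [B /MD'[]//|b ba B /MD'[_ [_]]|b s ba bs].
    exact.
  have [_ [fbinf fbad] _] := fmad b ba.
  (* A member of [D'] is almost inside some member of [T b]; if it meets [s], that member is [s] by
     almost disjointness. *)
  apply: Mc => [B [_ [_ /(_ b ba)[infB [t ft [Bt _]]]]] Bs|]; last exact: fbinf.
  suff <- : t = s by [].
  by apply: fbad => //; apply: almost_meets Bs => //; exact: almost_refl.
by exists T => a; have [] := TP a; split.
Qed.

Section LevelMatrix.
Context (K : Type) (Q : rel K) (woQ : well_order Q).
Context (D : K -> set (set nat)) (X : K -> set nat) (T : K -> set (set nat)).
Hypothesis TP : level_matrix Q D X T.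

Lemma lm_infinite a t : T a t -> infinite_set t.
Proof. by have [/madP[_ [Tinf _] _] _ _ _ _] := TP a => /Tinf. Qed.

Lemma lm_inj a s t : T a s -> T a t -> meets s t -> s = t.
Proof. by have [/madP[_ [_ Tad] _] _ _ _ _] := TP a; exact: Tad. Qed.

Lemma lm_hits a : hits_all (T a).
Proof. by have [/madP[]] := TP a. Qed.

Lemma lm_below a b s t : wlt Q b a -> T b s -> T a t -> meets s t ->
  almost_subset t s /\ infinite_set (s `\` t).
Proof.
move=> ba bs at_ st; have [_ _ _ /(_ b ba t at_)[inft [r br [tr rt]]] _] := TP a.
suff -> : s = r by [].
by apply: lm_inj bs br _; exact: almost_meets (almost_refl s) tr st.
Qed.

Lemma lm_pred a b t : wlt Q b a -> T a t ->
  exists2 s, T b s & almost_subset t s.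
Proof.
move=> ba at_; have [_ _ _ /(_ b ba t at_)[_ [r br [tr _]]] _] := TP a.
by exists r.
Qed.

End LevelMatrix.

(** * MA and the distributivity number *)

Lemma MA_indexed (I : Type) (A : set I) (E : I -> set (set nat)) :
  MA infinite_subsets almost_subset continuum -> A #<= continuum ->
  (forall i, A i -> forcing_dense infinite_subsets almost_subset (E i)) ->
  exists2 G, forcing_filter infinite_subsets almost_subset G &
    forall i, A i -> exists2 g, G g & E i g.
Proof.
move=> MAc Ac Ed; have [||G filG GE] := MAc (E @` A).
- exact: card_le_trans (card_image_le _ _) Ac.
- by move=> _ [i Ai <-]; exact: Ed.
exists G => // i Ai; have [g [Gg Eg]] := GE (E i) (ex_intro2 _ _ i Ai erefl).
by exists g.
Qed.

Lemma filter_meets G g h : forcing_filter infinite_subsets almost_subset G ->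
  G g -> G h -> meets g h.
Proof.
move=> [Ginf _ _ Gdir] Gg Gh; have [r [Gr rg rh]] := Gdir g h Gg Gh.
exact: common_meets (Ginf _ Gr) rg rh.
Qed.

Section Splitting.
Context (K : Type) (Q : rel K) (woQ : well_order Q).
Context (D : K -> set (set nat)) (X0 : K -> set nat) (T : K -> set (set nat)).
Hypothesis TP : level_matrix Q D X0 T.
Hypothesis Dod : forall a, open_dense (D a).
Hypothesis D0 : forall B, infinite_set B -> ~ forall a, D a B.

(** If [X] met only one member of each level, it would be almost contained in it, hence in every
    [D a] by openness. *)
Lemma exists_split X : infinite_set X -> exists a s t,
  [/\ T a s, T a t, s <> t & meets s X /\ meets t X].
Proof.
move=> infX; apply: contrapT => nsplit; apply: (D0 infX) => a.
have [t at_ tX] := lm_hits TP a infX.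
have [_ _ Do] := Dod a; apply: (Do _ t) => //.
  by have [_ TD _ _ _] := TP a; exact: TD.
apply: contrapT => /(lm_hits TP a)[s as_ sX].
apply: nsplit; exists a, s, t; split=> //.
  move=> st; apply: sX; suff -> : s `&` (X `\` t) = set0 by exact: finite_set0.
  by rewrite st; apply/seteqP; split=> // n [tn [_ /(_ tn)]].
by split=> //; apply: meets_subr sX => n [].
Qed.

(* Each set is split by some level; iterating along the binary tree and bounding *)
(* the countably many levels used puts continuum many branches on one level.    *)
Lemma continuum_split X : infinite_set X -> exists a,
  continuum #<= [set t | T a t /\ meets t X].
Proof.
move=> infX.
have [a0 _] := exists_split infX.
have /choice[sp spP] (Y : set nat) : exists u : K * (set nat * set nat),
    infinite_set Y -> [/\ T u.1 u.2.1, T u.1 u.2.2, u.2.1 <> u.2.2 &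
      meets u.2.1 Y /\ meets u.2.2 Y].
  have [/exists_split[a [s [t h]]]|nY] := pselect (infinite_set Y).
    by exists (a, (s, t)).
  by exists (a0, (set0, set0)).
(* Each node [Y] is split by two members of one level; its children are the traces of these
   members. *)
pose child Y (b : bool) := Y `&` (if b then (sp Y).2.1 else (sp Y).2.2).
pose Y (x : set nat) n := foldl child X (mkseq (fun i => `[< x i >]) n).
have YS x n : Y x n.+1 = child (Y x n) `[< x n >].
  by rewrite /Y mkseqS foldl_rcons.
have infY x n : infinite_set (Y x n).
  elim: n => // n IH; rewrite YS /child.
  by have [_ _ _ [sY tY]] := spP _ IH; case: ifP => _; exact: meetsC.
pose node (s : seq bool) := foldl child X s.
have infnode s : infinite_set (node s).
  elim/last_ind: s => // s b IH; rewrite /node foldl_rcons -/(node s) /child.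
  by have [_ _ _ [sY tY]] := spP _ IH; case: ifP => _; exact: meetsC.
(* The countably many splitting levels are bounded: otherwise a set strictly below all of them would
   lie below every level, hence in every [D a]. *)
have [a aP] : exists a, forall s, Q (sp (node s)).1 a.
  apply: contrapT => na.
  pose Dn n := strictly_below (T (sp (node (odflt [::] (unpickle n)))).1).
  have [|B [infB _] BD] := @open_dense_countable Dn setT _ infinite_nat.
    by move=> n; apply: open_dense_strictly_below; exact: (lm_hits TP).
  apply: (D0 infB) => a.
  have [s as_] : exists s, wlt Q a (sp (node s)).1.
    apply: contrapT => ns; apply: na; exists a => s; apply: (not_wlt woQ) => as_.
    by apply: ns; exists s.
  have := BD (pickle s); rewrite /Dn pickleK /= => -[_ [t Tt [Bt _]]].
  have [r ar tr] := lm_pred TP as_ Tt; have [_ _ Do] := Dod a.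
  apply: (Do _ r) => //; last exact: almost_trans Bt tr.
  by have [_ TD _ _ _] := TP a; exact: TD.
have aY x n : Q (sp (Y x n)).1 a by exact: aP.
(* A pseudo-intersection of each branch meets some member [t x] of the bounding level [a]; it
   remains to see that [t] is injective. *)
have /choice[W WP] x := pseudointersection (infY x) (fun n =>
  eq_ind_r (fun Z => Z `<=` _) (@subIsetl _ _ _) (YS x n)).
have /choice[t tP] x : exists t, T a t /\ meets t (W x).
  by have [infW _ _] := WP x; have [t at_ tW] := lm_hits TP a infW; exists t.
exists a; apply: (@card_le_inj _ _ _ _ t) => [x _|x y _ _ txy].
  have [at_ tW] := tP x; split=> //; apply: meets_subr tW.
  by have [_ /(_ _ _)h _] := WP x => k /h; rewrite /Y.
apply: contrapT => nxy.
(* At the first difference [n] the branches leave the same node through different children, so a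
   common value of [t] would meet both splitting members, which lie on a level not above [a]: they
   would coincide. *)
have [|n xyn nmin] := @ex_minnP (fun n => `[< x n >] != `[< y n >]).
  apply: contrapT => nn; apply: nxy; apply/funext => k; apply/propext.
  apply: asbool_eq_equiv; apply/eqP; apply: contrapT => /negP xyk.
  by apply: nn; exists k.
have Yxy : Y x n = Y y n.
  rewrite /Y; congr foldl; apply/eq_in_map => k; rewrite mem_iota add0n /= => kn.
  apply/eqP; apply: contraTT kn => /nmin; by rewrite -leqNgt.
have tsub z : meets (t z) (Y z n.+1).
  have [_ tW] := tP z; have [_ _ WY] := WP z.
  exact: almost_meets (almost_refl _) (WY _) tW.
have tpart z b : `[< z n >] = b ->
    meets (if b then (sp (Y z n)).2.1 else (sp (Y z n)).2.2) (t z).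
  move=> zb; have := tsub z; rewrite YS zb /child => h; apply: meetsC.
  by apply: meets_subr h => k [].
have [Ts Tt st _] := spP _ (infY x n).
have both : meets (sp (Y x n)).2.1 (t x) /\ meets (sp (Y x n)).2.2 (t x).
  have := tpart x _ erefl; have := tpart y _ erefl; rewrite -Yxy -txy.
  by move: xyn; case: `[< x n >]; case: `[< y n >].
have [tax _] := tP x.
have [la|la] := pselect ((sp (Y x n)).1 = a).
  apply: st; rewrite la in Ts Tt; case: both => m1 m2.
  by rewrite (lm_inj TP Ts tax m1) (lm_inj TP Tt tax m2).
have lta : wlt Q (sp (Y x n)).1 a by split.
case: both => m1 m2.
have [s1 _] := lm_below TP lta Ts tax m1.
have [s2 _] := lm_below TP lta Tt tax m2.
apply: st; apply: (lm_inj TP Ts Tt).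
exact: common_meets (lm_infinite TP tax) s1 s2.
Qed.

End Splitting.

(* Disjoint refinement: continuum many sets of size continuum have an injective *)
(* choice function, whose values can then be labelled independently.           *)
Lemma exists_labelling (K : Type) (S : K -> set nat -> set (set nat)) :
  (forall X, infinite_set X -> exists a, continuum #<= S a X) ->
  exists l : set nat -> set nat, forall X x, infinite_set X ->
    exists2 a, True & exists2 t, S a X t & l t = x.
Proof.
move=> Sbig.
have [a0 _] := Sbig _ infinite_nat.
have /choice[al alP] X : exists a, infinite_set X -> continuum #<= S a X.
  have [/Sbig[a h]|nX] := pselect (infinite_set X); first by exists a.
  by exists a0.
(* Requests (set, label) are listed in an initial order, so fewer than continuum many values are
   taken before each stage and a fresh one remains. *)
have [J [R [[woR iniR] Jc]]] := exists_initial_ordinal [set: set nat * set nat].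
move: Jc; rewrite card_eq_le => /andP[Jle leJ].
have [e [_ esurj]] := card_le_surjP (t0 := (set0, set0)) I leJ.
have [||f fP] := @wf_choice J (wlt R) (set nat) (fun j f v =>
   infinite_set (e j).1 -> S (al (e j).1) (e j).1 v /\
     forall i, wlt R i j -> f i <> v) (wlt_wf woR).
- move=> j f g v fg h infX; have [Sv fv] := h infX; split=> // i ij.
  by rewrite -fg//; exact: fv.
- move=> j f _; apply: contrapT => nv.
  have [infX|ninf] := pselect (infinite_set (e j).1); last first.
    by apply: nv; exists set0.
  apply: (negP (iniR j)); apply: card_le_trans Jle _.
  apply: card_le_trans card_continuum_prod _; apply: card_le_trans (alP _ infX) _.
  apply: (@card_le_surj _ _ _ _ f) => v Sv.
  apply: contrapT => nf; apply: nv; exists v => _; split=> // i [ij nij] fi.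
  by apply: nf; exists i.
(* Values chosen for different requests are distinct, so each carries at most one label. *)
have /choice[l lP] t : exists x, forall j, infinite_set (e j).1 -> f j = t ->
    (e j).2 = x.
  have [[j [infj ft]]|nj] := pselect (exists j, infinite_set (e j).1 /\ f j = t);
    last by exists set0 => j infj fj; case: nj; exists j.
  exists (e j).2 => i infi fi; suff -> : i = j by [].
  have [ij|//|ji] := wlt_or woR i j.
    by have [_ /(_ i ij)] := fP j infj; rewrite fi ft.
  by have [_ /(_ j ji)] := fP i infi; rewrite fi ft.
exists l => X x infX; have [j _ ej] := esurj (X, x) I.
have infj : infinite_set (e j).1 by rewrite ej.
have [Sf _] := fP j infj; exists (al X) => //; exists (f j).
  by move: Sf; rewrite ej.
by rewrite -(lP (f j) j)// ej.
Qed.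

(** A least counterexample to distributivity yields a matrix indexed by its cardinal [K]. By the
    labelling, the sets lying below a member labelled [x] are dense for each [x]; a filter meeting
    all of them maps [K] onto the labels. *)
Lemma MA_distributivity :
  MA infinite_subsets almost_subset continuum ->
  forall F : set (set (set nat)), (forall D, F D -> open_dense D) ->
    \bigcap_(D in F) D = set0 -> continuum #<= F.
Proof.
move=> MAc F Fod F0.
pose bad := [set F : set (set (set nat)) | (forall D, F D -> open_dense D) /\
  \bigcap_(D in F) D = set0].
have [|H [Hod H0] Hmin] := @exists_least_card _ bad; first by exists F.
apply: card_le_trans (Hmin F (conj Fod F0)).
have [D0 HD0] : H !=set0.
  apply: contrapT => nH; have : (\bigcap_(D in H) D) set0.
    by move=> D HD; case: nH; exists D.
  by rewrite H0.
have [K [Q [iniQ KH]]] := exists_initial_ordinal H.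
move: KH; rewrite card_eq_le => /andP[KH HK].
have [D [DH Dsurj]] := card_le_surjP HD0 HK.
have Dod a : open_dense (D a) by apply: Hod.
have [|T TP] := @exists_level_matrix K Q D (fun=> setT) iniQ _ Dod
  (fun=> infinite_nat).
  by move=> E Eod E0; apply: card_le_trans KH (Hmin E _).
have [woQ _] := iniQ.
have DN B : infinite_set B -> ~ forall a, D a B.
  move=> _ DB; suff : (\bigcap_(E in H) E) B by rewrite H0.
  by move=> E /Dsurj[a _ <-].
have [l lP] := exists_labelling (fun X => continuum_split woQ TP Dod DN (X := X)).
pose E x := [set B | infinite_set B /\
  exists a, exists2 t, T a t & almost_subset B t /\ l t = x].
have [|x _|G filG GE] := @MA_indexed (set nat) setT E MAc; first exact: card_lexx.
  split=> [B []//|X infX]; have [a _ [t [at_ tX] lt]] := lP X x infX.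
  exists (t `&` X); last by apply: sub_almost => n [].
  by split=> //; exists a, t => //; split=> //; apply: sub_almost => n [].
have [Ginf _ Gup _] := filG.
apply: card_le_trans KH.
(* The filter contains at most one member of level [a]; [r a] is its label. *)
pose r a := l (xget set0 [set t | T a t /\ G t]).
apply: (@card_le_surj _ _ _ _ r) => x _.
have [B GB [infB [a [t at_ [Bt ltx]]]]] := GE x I.
exists a => //; rewrite /r (@xget_unique _ _ _ t)//.
  by split=> //; apply: Gup Bt => //; exact: (lm_infinite TP at_).
move=> s [as_ Gs]; apply: (lm_inj TP as_ at_); apply: (filter_meets filG) => //.
by apply: Gup Bt => //; exact: (lm_infinite TP at_).
Qed.

(** For the upper bound, take for each infinite [A] the open dense set of all [B] that do not almost
    contain [A]: no [B] survives the choice [A = B]. *)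
Lemma MA_distributivity_number :
  MA infinite_subsets almost_subset continuum -> is_distributivity_number continuum.
Proof.
move=> MAc; split; last by move=> F [Fod F0]; exact: MA_distributivity.
pose E (A : set nat) := [set B | infinite_set B /\ ~ almost_subset A B].
pose F := E @` infinite_subsets.
have FE A : infinite_set A -> F (E A) by exists A.
have F0 : \bigcap_(D in F) D = set0.
  apply/seteqP; split=> // B FB; have infB : infinite_set B.
    by have [] := FB (E setT) (FE _ infinite_nat).
  by have [_ []] := FB (E B) (FE _ infB); exact: almost_refl.
have Fod D : F D -> open_dense D.
  move=> [A infA <-]; split=> [B []//|X infX|X B infX [infB AB] XB]; last first.
    by split=> // AX; apply: AB; exact: almost_trans XB.
  have [Y [YX infY infXY]] := infinite_split infX.
  (* The infinite set [A] cannot be almost contained in both of two disjoint halves. *)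
  have [AY|nAY] := pselect (almost_subset A Y); last by exists Y.
  exists (X `\` Y); first by move=> n [].
  split=> // AXY; apply: infA; apply: sub_finite_set (almost_setI AY AXY).
  by move=> n An; split=> // -[Yn [_ /(_ Yn)]].
exists F; first by [].
rewrite card_eq_le MA_distributivity// andbT.
apply: card_le_trans (card_image_le _ _) _; exact: card_leT.
Qed.

(** * Base trees and cofinal branches *)

Lemma almost_supsetP A B : reflect (almost_subset B A) (almost_supset A B).
Proof. exact: asboolP. Qed.

Lemma least_card_eq (T U V : Type) (P : set (set T)) (A : set U) (B : set V) :
  A #= B -> least_card P A -> least_card P B.
Proof.
move=> AB [[D PD DA] Amin]; split; first by exists D => //; exact: card_eq_trans AB.
move=> E /Amin AE; apply: card_le_trans AE.
by move: AB; rewrite card_eq_le => /andP[].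
Qed.

Section BranchOfFilter.
Context (K : Type) (Q : rel K) (S : set (set nat)).
Hypothesis woQ : well_order Q.
Hypothesis btS : base_tree Q S.

Let L a := level S almost_supset Q a.

Lemma bt_mad a : [/\ infinite_set (L a), ad_family (L a) & hits_all (L a)].
Proof. by have [_ _ _ [_ Lmad _]] := btS; apply/madP. Qed.

Lemma bt_inj a s t : L a s -> L a t -> meets s t -> s = t.
Proof. by have [_ [_ Lad] _] := bt_mad a; exact: Lad. Qed.

(** The isomorphism from the predecessors of [t] restricts to the predecessors of the element sent
    to [a], which is therefore on level [a]. *)
Lemma bt_pred a b t : wlt Q a b -> L b t ->
  exists2 s, L a s & almost_subset t s.
Proof.
move=> [ab nab] [St [f [ffun finj fsurj] fmono]].
have [_ [_ Rtr Ranti _] _ _] := btS.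
have {Ranti} Ranti x y : S x -> S y -> almost_supset x y -> almost_supset y x -> x = y.
  by move=> Sx Sy xy yx; apply: Ranti; rewrite ?inE ?xy.
have [s Ps fs] := fsurj a (And3 I ab nab).
have [Ss st nst] := Ps.
exists s; last exact/almost_supsetP.
have sub r : strict_preds S almost_supset s r -> strict_preds S almost_supset t r.
  move=> [Sr rs nrs]; split=> //; first exact: Rtr st.
  by move=> rt; apply: nst; apply: Ranti => //; rewrite -rt.
have mono x y : strict_preds S almost_supset t x -> strict_preds S almost_supset t y ->
    Q (f x) (f y) = almost_supset x y.
  by move=> tx ty; apply: fmono; rewrite inE.
have inj x y : strict_preds S almost_supset t x -> strict_preds S almost_supset t y ->
    f x = f y -> x = y.
  by move=> tx ty; apply: finj; rewrite inE.
split=> //; exists f; last by move=> x y; rewrite !inE => /sub tx /sub ty; exact: mono.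
split=> [r rP|x y|c [_ ca nca]].
- have [Sr rs nrs] := rP; split=> //; first by rewrite -fs mono//; exact: sub.
  by rewrite -fs => /inj E; apply: nrs; apply: E => //; exact: sub.
- by rewrite !inE => /sub tx /sub ty; exact: inj.
- have [|r rP frc] := fsurj c.
    split=> //; first exact: wo_trans woQ _ _ _ ca ab.
    by move=> cb; apply: nca; apply: (wo_anti woQ ca); rewrite cb.
  have [Sr rt nrt] := rP; exists r => //; split=> //; last first.
    by move=> rs; apply: nca; rewrite -frc rs.
  by rewrite -mono// fs frc.
Qed.

Lemma bt_le a b s t : Q a b -> L a s -> L b t -> meets s t -> almost_subset t s.
Proof.
move=> ab as_ bt st; have [E|nab] := pselect (a = b).
  by rewrite -E in bt; rewrite (bt_inj as_ bt st); exact: almost_refl.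
have [r ar tr] := bt_pred (conj ab nab) bt; suff -> : s = r by [].
by apply: (bt_inj as_ ar); exact: almost_meets (almost_refl _) tr st.
Qed.

(** Compatible members of a base tree are comparable, so the trace of [G] is a chain. It is maximal:
    any element of a larger chain is comparable with the trace's element on its own level, hence
    equal to it. *)
Lemma filter_cofinal_branch G :
  forcing_filter infinite_subsets almost_subset G ->
  (forall a, exists2 t, L a t & G t) -> cofinal_branch Q S (S `&` G).
Proof.
move=> filG GL; have [Sinf _ [Slev _] _] := btS.
have cof a : (S `&` G) `&` L a !=set0.
  by have [t at_ Gt] := GL a; exists t; split=> //; split=> //; case: at_.
split=> //; split=> [t []//|x y|C CS Cch BC].
  rewrite !inE => -[Sx Gx] [Sy Gy]; have xy := filter_meets filG Gx Gy.
  have [a ax] := Slev x Sx; have [b by_] := Slev y Sy.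
  have [ab|ba] := wo_total woQ a b; apply/orP.
    by left; apply/almost_supsetP; exact: bt_le ab ax by_ xy.
  by right; apply/almost_supsetP; exact: bt_le ba by_ ax (meetsC xy).
apply/seteqP; split=> // c Cc; have Sc := CS c Cc.
have [a ac] := Slev c Sc; have [t [Bt at_]] := cof a.
suff -> : c = t by []; apply: (bt_inj ac at_).
have Ct := BC t Bt; have St := CS t Ct.
have := Cch c t; rewrite !inE => /(_ Cc Ct) /orP[] /almost_supsetP h.
  exact: common_meets (Sinf _ St) h (almost_refl _).
exact: common_meets (Sinf _ Sc) (almost_refl _) h.
Qed.

End BranchOfFilter.

Lemma MA_cofinal_branch :
  MA infinite_subsets almost_subset continuum ->
  forall (K : Type) (Q : rel K), is_distributivity_ordinal Q ->
    forall S, base_tree Q S -> exists B, cofinal_branch Q S B.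
Proof.
move=> MAc K Q [[woQ _] [_ Kmin]] S btS.
have [[F /Kmin KF] Fc _] := MA_distributivity_number MAc.
have Kc : [set: K] #<= continuum.
  by apply: card_le_trans KF _; move: Fc; rewrite card_eq_le => /andP[].
pose E a := almost_closure (level S almost_supset Q a).
have [a _|G filG GE] := MA_indexed (E := E) MAc Kc.
  split=> [B []//|X infX]; have [_ _ /(_ _ infX)[t at_ tX]] := bt_mad btS a.
  exists (t `&` X); last by apply: sub_almost => n [].
  by split=> //; exists t => //; apply: sub_almost => n [].
exists (S `&` G); apply: filter_cofinal_branch => // a.
have [g Gg [_ [t at_ gt]]] := GE a I; exists t => //.
have [_ _ Gup _] := filG; apply: Gup gt => //.
by have [_ [Linf _] _] := bt_mad btS a; exact: Linf.
Qed.

(** By induction on values, two isomorphisms of one order onto initial segments agree pointwise, so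
    the segments coincide. *)
Lemma order_iso_seg_inj (U K : Type) (A : set U) (R : rel U) (Q : rel K) a b :
  well_order Q -> order_iso A R (strict_preds setT Q a) Q ->
  order_iso A R (strict_preds setT Q b) Q -> a = b.
Proof.
move=> woQ [f [ffun finj fsurj] fmono] [g [gfun ginj gsurj] gmono].
have mono x y : A x -> A y -> wlt Q (f x) (f y) <-> wlt Q (g x) (g y).
  move=> Ax Ay; have fxy : Q (f x) (f y) = R x y by apply: fmono; rewrite inE.
  have gxy : Q (g x) (g y) = R x y by apply: gmono; rewrite inE.
  have fi : f x = f y -> x = y by apply: finj; rewrite inE.
  have gi : g x = g y -> x = y by apply: ginj; rewrite inE.
  rewrite /wlt fxy gxy; split=> -[Rxy nxy]; split=> // E.
    by apply: nxy; rewrite (gi E).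
  by apply: nxy; rewrite (fi E).
have fg c : forall x, A x -> f x = c -> g x = c.
  elim/(well_founded_ind (wlt_wf woQ)) : c => c IH x Ax fxc.
  have [gc|//|cg] := wlt_or woQ (g x) c.
    have ga : wlt Q (g x) a.
      have [_ h1 h2] := ffun x Ax; rewrite fxc in h1 h2.
      by apply: wlt_trans woQ _ _ _ gc _.
    have [y Ay fy] := fsurj (g x) (And3 I ga.1 ga.2).
    have gy := IH _ gc y Ay fy; have : wlt Q (f y) (f x) by rewrite fy fxc.
    by move=> /(mono _ _ Ay Ax); rewrite gy => -[].
  have cb : wlt Q c b.
    have [_ h1 h2] := gfun x Ax.
    exact: wlt_trans woQ _ _ _ cg (conj h1 h2).
  have [y Ay gy] := gsurj c (And3 I cb.1 cb.2).
  have : wlt Q (g y) (g x) by rewrite gy.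
  move=> /(mono _ _ Ay Ax); rewrite fxc => fyc.
  have := IH _ fyc y Ay erefl; rewrite gy => E.
  by move: fyc; rewrite -E => -[].
have [ab|//|ba] := wlt_or woQ a b.
  have [x Ax gx] := gsurj a (And3 I ab.1 ab.2).
  by have [_ _] := ffun x Ax; rewrite -(fg _ x Ax erefl).
have [x Ax fx] := fsurj b (And3 I ba.1 ba.2).
by have [_ _] := gfun x Ax; rewrite (fg _ x Ax fx).
Qed.

(** * A refining matrix as a base tree *)

Section MatrixTree.
Context (K : Type) (Q : rel K) (iniQ : initial_ordinal Q).
Context (D : K -> set (set nat)) (X : K -> set nat) (T : K -> set (set nat)).
Hypothesis TP : level_matrix Q D X T.
Hypothesis infK : infinite_set [set: K].

Let woQ : well_order Q := iniQ.1.
Definition matrix_tree := \bigcup_a T a.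
Let R := almost_supset.
Let S := matrix_tree.

Lemma mt_level_uniq a b t : T a t -> T b t -> a = b.
Proof.
move=> at_ bt; have tt := meetsxx (lm_infinite TP at_).
have [ab|//|ba] := wlt_or woQ a b.
  by have [_] := lm_below TP ab at_ bt tt; rewrite setDv => /(_ (finite_set0 _)).
by have [_] := lm_below TP ba bt at_ tt; rewrite setDv => /(_ (finite_set0 _)).
Qed.

Lemma mt_le a b s t : T b s -> T a t -> almost_subset t s -> Q b a.
Proof.
move=> bs at_ ts; apply: (not_wlt woQ) => ab.
have [|_] := lm_below TP ab at_ bs; last exact.
exact: common_meets (lm_infinite TP at_) (almost_refl _) ts.
Qed.

Lemma mt_ge a b s t : T b s -> T a t -> Q b a -> meets s t -> almost_subset t s.
Proof.
move=> bs at_ ba st; have [E|nba] := pselect (b = a).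
  by rewrite E in bs; rewrite (lm_inj TP bs at_ st); exact: almost_refl.
by have [] := lm_below TP (conj ba nba) bs at_ st.
Qed.

Lemma mt_preds_meets a t x y : T a t -> strict_preds S R t x ->
  strict_preds S R t y -> meets x y.
Proof.
move=> at_ [_ /almost_supsetP tx _] [_ /almost_supsetP ty _].
exact: common_meets (lm_infinite TP at_) tx ty.
Qed.

Lemma mt_level_fun : exists lv : set nat -> K, forall t a, T a t -> lv t = a.
Proof.
have [a0 _] := infinite_setN0 infK.
suff /choice[lv lvP] : forall t, exists b, forall a, T a t -> b = a by exists lv.
move=> t.
have [[a at_]|na] := pselect (exists a, T a t).
  by exists a => b; exact: mt_level_uniq.
by exists a0 => a at_; case: na; exists a.
Qed.

Lemma mt_iso a t : T a t ->
  order_iso (strict_preds S R t) R (strict_preds setT Q a) Q.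
Proof.
move=> at_; have [lv lvP] := mt_level_fun; exists lv; first split.
- move=> s [[b _ bs] /almost_supsetP ts nst]; rewrite (lvP _ _ bs).
  split=> //; first exact: mt_le bs at_ ts.
  move=> ba; apply: nst; rewrite ba in bs; apply: (lm_inj TP bs at_).
  exact: common_meets (lm_infinite TP at_) ts (almost_refl _).
- move=> x y; rewrite !inE => Px Py; have xy := mt_preds_meets at_ Px Py.
  case: Px Py => [[b _ bx] _ _] [[c _ cy] _ _].
  rewrite (lvP _ _ bx) (lvP _ _ cy) => bc; rewrite -bc in cy.
  exact: lm_inj TP _ _ _ bx cy xy.
- move=> b [_ ba nba]; have [s bs ts] := lm_pred TP (conj ba nba) at_.
  exists s; last exact: lvP.
  split; [by exists b|exact/almost_supsetP|].
  by move=> st; apply: nba; rewrite st in bs; exact: mt_level_uniq bs at_.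
- move=> x y; rewrite !inE => Px Py; have xy := mt_preds_meets at_ Px Py.
  case: Px Py => [[b _ bx] _ _] [[c _ cy] _ _].
  rewrite (lvP _ _ bx) (lvP _ _ cy).
  apply/idP/idP => [bc|/almost_supsetP yx]; last exact: mt_le bx cy yx.
  by apply/almost_supsetP; exact: mt_ge bx cy bc xy.
Qed.

Lemma mt_level a : level S R Q a = T a.
Proof.
apply/seteqP; split=> t; last first.
  by move=> at_; split; [exists a|exact: mt_iso].
move=> [[b _ bt] isot]; suff -> : a = b by [].
exact: order_iso_seg_inj woQ isot (mt_iso bt).
Qed.

Lemma mt_anti x y : S x -> S y -> R x y -> R y x -> x = y.
Proof.
move=> [a _ ax] [b _ by_] /almost_supsetP yx /almost_supsetP xy.
have E : a = b.
  by apply: (wo_anti woQ); [exact: mt_le ax by_ yx|exact: mt_le by_ ax xy].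
rewrite -E in by_; apply: (lm_inj TP ax by_).
exact: common_meets (lm_infinite TP ax) (almost_refl _) xy.
Qed.

Lemma mt_tree : tree S R.
Proof.
split=> [A|B A C|x y|t [a _ at_]].
- by apply/almost_supsetP; exact: almost_refl.
- move=> /almost_supsetP BA /almost_supsetP CB; apply/almost_supsetP.
  exact: almost_trans CB BA.
- by rewrite !inE => Sx Sy /andP[xy yx]; exact: mt_anti.
apply: antisymmetric_wo_chain.
  move=> x y; rewrite !inE => -[Sx _ _] [Sy _ _] /andP[xy yx]; exact: mt_anti.
move=> A AP [x Ax]; have [f [ffun _ _] fmono] := mt_iso at_.
have [|_ [z Az <-] zmin] := @wo_min _ _ woQ (f @` [set` A]).
  by exists (f x), x.
exists z; split=> // y Ay; rewrite -fmono; [|exact: AP..].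
by apply: zmin; exists y.
Qed.

(** An infinite initial ordinal has no last element [a], since removing [a] would not change the
    cardinality. *)
Lemma mt_succ a : exists2 b, wlt Q a b & forall c, wlt Q a c -> Q b c.
Proof.
suff [b ab] : exists b, wlt Q a b.
  by have [|c ac cmin] := @wo_min _ _ woQ [set c | wlt Q a c]; [exists b|exists c].
apply: contrapT => nb; apply: (negP (iniQ.2 a)).
apply: card_le_trans (card_infinite_setD1 a infK) _; apply: subset_card_le => b [_ ba].
by split=> //; apply: (not_wlt woQ) => ab; apply: nb; exists b.
Qed.

(** The members of the next level below [t] are immediate successors, and the matrix provides
    continuum many. *)
Lemma mt_immediate_succs t : S t -> immediate_succs S R t #= continuum.
Proof.
move=> [a _ at_]; rewrite card_eq_le card_leT/=.
have [b ab bmin] := mt_succ a.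
have [_ _ _ _ /(_ a t ab at_) bc] := TP b.
apply: card_le_trans bc _; apply: subset_card_le => s [bs st].
split; first by exists b.
  split; [by exists a|exact/almost_supsetP|move=> ts].
  by rewrite -ts in bs; case: ab => _; apply; exact: mt_level_uniq at_ bs.
move=> r [[c _ cr] /almost_supsetP sr nrs] [/almost_supsetP rt ntr].
have infs := lm_infinite TP bs; apply: nrs.
have bcle : Q b c.
  apply: bmin; split; first exact: mt_le at_ cr rt.
  move=> ac; rewrite -ac in cr; apply: ntr; apply: (lm_inj TP at_ cr).
  exact: common_meets infs st sr.
have E : b = c by apply: (wo_anti woQ bcle); exact: mt_le cr bs sr.
rewrite -E in cr; apply: (lm_inj TP cr bs).
exact: common_meets infs sr (almost_refl _).
Qed.

Lemma mt_base_tree : (forall A, infinite_set A -> exists a, X a = A) ->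
  base_tree Q S.
Proof.
move=> Xsurj; split.
- by move=> t [a _ at_]; exact: lm_infinite TP _ _ at_.
- exact: mt_tree.
- split=> [t [a _ at_]|a]; first by exists a; rewrite mt_level.
  by rewrite mt_level; have [t at_ _] := lm_hits TP a infinite_nat; exists t.
split=> [||A /Xsurj[a <-]]; first exact: mt_immediate_succs.
  by move=> a; rewrite mt_level; have [] := TP a.
by have [_ _ [t at_ tX] _ _] := TP a; exists t => //; exists a.
Qed.

End MatrixTree.

Lemma enumerate_dense (I : Type) (i0 : I) (F : set (set (set nat))) :
  F #<= [set: I] ->
  (forall D, F D -> forcing_dense infinite_subsets almost_subset D) ->
  exists d : I -> set (set nat),
    (forall i, forcing_dense infinite_subsets almost_subset (d i)) /\
    forall D, F D -> exists i, d i = D.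
Proof.
move=> FI Fd; have [[D0 FD0]|F0] := pselect (F !=set0).
  have [d [dF dsurj]] := card_le_surjP FD0 FI.
  exists d; split=> [i|D /dsurj[i _ di]]; first exact/Fd/dF.
  by exists i.
(* With nothing to enumerate, the dense set of all infinite sets fills every index. *)
exists (fun=> infinite_subsets); split=> [_|D FD]; last by case: F0; exists D.
by split=> // X infX; exists X => //; exact: almost_refl.
Qed.

(** With K of size c = h, level [a] of the matrix is placed inside the closure of the [a]-th given
    dense set, while [X] runs through all infinite sets. The upward closure of a cofinal branch is
    the filter. *)
Lemma cofinal_branch_MA :
  is_distributivity_number continuum ->
  (forall (K : Type) (Q : rel K), is_distributivity_ordinal Q ->
    forall S, base_tree Q S -> exists B, cofinal_branch Q S B) ->
  MA infinite_subsets almost_subset continuum.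
Proof.
move=> hc trees F Fc Fd.
have [K [Q [iniQ Kc]]] := exists_initial_ordinal continuum.
have hK : is_distributivity_number [set: K].
  by apply: least_card_eq hc; rewrite card_eq_sym.
move: (Kc); rewrite card_eq_le => /andP[Kle leK].
have [e [_ esurj]] := card_le_surjP (t0 := setT) I leK.
have [a0 _ _] := esurj setT I.
have infK : infinite_set [set: K].
  apply/infiniteP; apply: card_le_trans leK.
  apply: (@card_le_inj _ _ _ _ (fun n => [set n])) => // m n _ _.
  by move=> /(congr1 (fun A => A m)) /= E; rewrite -E.
have [d [dd dF]] := enumerate_dense a0 (card_le_trans Fc leK) Fd.
(* Finite sets in the enumeration are replaced by all of omega. *)
pose X a := if pselect (infinite_set (e a)) is left _ then e a else setT.
have infX a : infinite_set (X a).
  by rewrite /X; case: pselect => // _; exact: infinite_nat.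
have [||T TP] := exists_level_matrix (D := fun a => almost_closure (d a)) iniQ _ _ infX.
- by move=> E Eod E0; exact: hK.2.
- by move=> a; exact: open_dense_closure.
have btT : base_tree Q (matrix_tree T).
  apply: (mt_base_tree iniQ TP infK) => A infA.
  by have [a _ ea] := esurj A I; exists a; rewrite /X ea; case: pselect.
have [B [[BS Bch _] Bcof]] := trees K Q (conj iniQ hK) _ btT.
have [Sinf _ _ _] := btT.
exists [set Y | infinite_set Y /\ exists2 b, B b & almost_subset b Y].
  split.
  - by move=> Y [].
  - have [b [Bb _]] := Bcof a0; exists b; split; first exact/Sinf/BS.
    by exists b => //; exact: almost_refl.
  - move=> p q [_ [b Bb bp]] infq pq; split=> //; exists b => //.
    exact: almost_trans pq.
  - move=> p q [_ [b Bb bp]] [_ [c Bc cq]].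
    have GB y : B y -> infinite_set y /\ exists2 b, B b & almost_subset b y.
      by move=> By; split; [exact/Sinf/BS|exists y => //; exact: almost_refl].
    have := Bch b c; rewrite !inE => /(_ Bb Bc) /orP[] /almost_supsetP h.
      by exists c; split=> //; [exact: GB|exact: almost_trans bp].
    by exists b; split=> //; [exact: GB|exact: almost_trans cq].
move=> D FD; have [a da] := dF D FD; have [b [Bb]] := Bcof a.
rewrite (mt_level iniQ TP infK) => Tb.
have [_ /(_ b Tb)[infb [g dg bg]] _ _ _] := TP a.
rewrite da in dg; exists g; split=> //; split; last by exists b.
by have [Dinf _] := Fd D FD; exact: Dinf.
Qed.

(** * Free ultrafilters *)

Lemma open_omega_star_basic A : open (omega_star_basic A).
Proof. by exists [set A] => //; rewrite bigcup_set1. Qed.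

Lemma open_omega_starP (U : set omega_star) p : open U -> U p ->
  exists2 A, omega_star_basic A p & omega_star_basic A `<=` U.
Proof. by move=> [E _ <-] [A EA Ap]; exists A => // q Aq; exists A. Qed.

Lemma omega_star_disjoint (p : omega_star) A B :
  omega_star_basic A p -> omega_star_basic B p -> A `&` B = set0 -> False.
Proof.
move=> pA pB AB; have pU := omega_star_ultra p.
have : (\val p : set_system nat) (A `&` B) by exact: filterI.
rewrite AB; exact: (@filter_not_empty _ (\val p) _).
Qed.

Lemma omega_star_cofinite (p : omega_star) A :
  finite_set A -> omega_star_basic (~` A) p.
Proof.
have pU := omega_star_ultra p; move=> /finite_seqP[s ->].
have /set_mem[_ p0] := valP p.
have p1 n : (\val p : set_system nat) (~` [set n]).
  have [B pB nBn] : exists2 B, (\val p : set_system nat) B & ~ B n.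
    apply: contrapT => nB; have : (\bigcap_(A in \val p) A) n.
      by move=> B pB; apply: contrapT => nBn; apply: nB; exists B.
    by rewrite p0.
  by apply: filterS pB => k Bk kn; apply: nBn; rewrite -kn.
elim: s => [|n s IH]; first by apply: filterS filterT => k _.
apply: filterS (filterI (p1 n) IH) => k [/= kn ks].
by rewrite inE => /orP[/eqP|].
Qed.

Lemma omega_star_infinite (p : omega_star) A :
  omega_star_basic A p -> infinite_set A.
Proof.
move=> pA finA.
exact: omega_star_disjoint pA (omega_star_cofinite p finA) (setICr A).
Qed.

Lemma omega_star_almost (p : omega_star) A B :
  almost_subset A B -> omega_star_basic A p -> omega_star_basic B p.
Proof.
move=> AB pA; have pU := omega_star_ultra p.
apply: filterS (filterI pA (omega_star_cofinite p AB)) => k [Ak nAB].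
by apply: contrapT => nB; apply: nAB.
Qed.

Lemma omega_star_filter (p : omega_star) :
  forcing_filter infinite_subsets almost_subset [set A | omega_star_basic A p].
Proof.
have pU := omega_star_ultra p; split=> [A pA|||A B pA pB].
- exact: omega_star_infinite pA.
- by exists setT; exact: filterT.
- by move=> A B pA _ /omega_star_almost; apply.
- exists (A `&` B); split; first exact: filterI.
    by apply: sub_almost => n [].
  by apply: sub_almost => n [].
Qed.

(** Closing [G] under almost supersets adds every cofinite set, so the ultrafilter obtained is
    free. *)
Lemma extend_to_omega_star G :
  forcing_filter infinite_subsets almost_subset G ->
  exists p : omega_star, forall g, G g -> omega_star_basic g p.
Proof.
move=> [Ginf [g0 Gg0] _ Gdir].
pose F : set_system nat := [set Y | exists2 g, G g & almost_subset g Y].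
have FF : ProperFilter F.
  apply: Build_ProperFilter_ex.
    move=> P [g Gg gP]; apply: infinite_setN0.
    exact: almost_infinite gP (Ginf _ Gg).
  split.
  - by exists g0 => //; exact: sub_almost.
  - move=> P Q [g Gg gP] [h Gh hQ]; have [r [Gr rg rh]] := Gdir g h Gg Gh.
    exists r => //; apply: almost_setI; first exact: almost_trans gP.
    exact: almost_trans hQ.
  - move=> P Q PQ [g Gg gP]; exists g => //.
    by apply: almost_trans gP _; exact: sub_almost.
have [p [pU Fp]] := ultraFilterLemma FF.
have pP : [set p : set_system nat |
    UltraFilter p /\ \bigcap_(A in p) A = set0] p.
  split=> //; apply/seteqP; split=> // n pn.
  suff /pn : p (~` [set n]) by apply.
  apply: Fp; exists g0 => //; apply: sub_finite_set (finite_set1 n).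
  by move=> k [_ /contrapT].
exists (SigSub (mem_set pP)) => g Gg.
by apply: Fp; exists g => //; exact: almost_refl.
Qed.

Lemma omega_star_basic_neq0 A : infinite_set A -> omega_star_basic A !=set0.
Proof.
move=> infA; have [|p pP] := @extend_to_omega_star
    [set Y | infinite_set Y /\ almost_subset A Y].
  split=> [Y []//||Y Z [_ AY] infZ YZ|Y Z [infY AY] [infZ AZ]].
  - by exists A; split=> //; exact: almost_refl.
  - by split=> //; exact: almost_trans YZ.
  - exists A; split=> //; split=> //; exact: almost_refl.
by exists p; apply: pP; split=> //; exact: almost_refl.
Qed.

Lemma baire_number_MA (U : Type) (N : set U) :
  is_baire_number omega_star N -> ~~ (N #<= continuum) ->
  MA infinite_subsets almost_subset continuum.
Proof.
move=> [_ Nmin] Nc F Fc Fd.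
pose V (D : set (set nat)) := \bigcup_(d in D) omega_star_basic d.
have [p pV] : (\bigcap_(W in V @` F) W) !=set0.
  apply: contrapT => V0; apply: (negP Nc).
  apply: card_le_trans (card_le_trans (card_image_le V F) Fc); apply: Nmin.
  split; last by apply/seteqP; split=> // p pV; apply: V0; exists p.
  move=> _ [D FD <-]; have [Dinf Dd] := Fd D FD; split.
    by apply: bigcup_open => d _; exact: open_omega_star_basic.
  move=> O [q Oq] openO; have [A Aq AO] := open_omega_starP openO Oq.
  have [d Dd' dA] := Dd A (omega_star_infinite Aq).
  have [p dp] := omega_star_basic_neq0 (Dinf _ Dd').
  exists p; split; last by exists d.
  by apply: AO; exact: omega_star_almost dp.
exists [set A | omega_star_basic A p]; first exact: omega_star_filter.
move=> D FD; have [|d Dd dp] := pV (V D); first by exists D.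
by exists d.
Qed.

(** There are no isolated points: an infinite set has two disjoint infinite halves, each belonging
    to some free ultrafilter. These sets show that the Baire number is defined. *)
Lemma open_dense_omega_star_setC1 (p : omega_star) :
  open (~` [set p]) /\ dense (~` [set p]).
Proof.
split.
  rewrite (_ : ~` _ = \bigcup_(A in [set A | ~ omega_star_basic A p])
      omega_star_basic A).
    by apply: bigcup_open => A _; exact: open_omega_star_basic.
  apply/seteqP; split=> q => [nqp|[A nA Aq] qp]; last by rewrite qp in Aq.
  apply: contrapT => nA; apply: nqp; apply: val_inj => /=.
  have qp : \val q `<=` \val p.
    by move=> A qA; apply: contrapT => pA; apply: nA; exists A.
  apply/seteqP; split=> // A pA; apply: contrapT => nqA.
  have qU := omega_star_ultra q; have [//|/qp pC] := in_ultra_setVsetC A qU.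
  exact: omega_star_disjoint pA pC (setICr A).
move=> O [q Oq] openO; have [A Aq AO] := open_omega_starP openO Oq.
have [Y [YA infY infAY]] := infinite_split (omega_star_infinite Aq).
have [r Yr] := omega_star_basic_neq0 infY.
have [s AYs] := omega_star_basic_neq0 infAY.
have [rp|rp] := pselect (r = p); last first.
  exists r; split=> //; apply: AO; apply: omega_star_almost Yr.
  exact: sub_almost.
exists s; split.
  by apply: AO; apply: omega_star_almost AYs; apply: sub_almost => n [].
move=> sp; rewrite sp -rp in AYs; apply: (omega_star_disjoint Yr AYs).
by apply/seteqP; split=> // n [Yn [_ /(_ Yn)]].
Qed.

(** For [U] dense open, the sets [A] whose basic open set lies in [U] are dense in the pre-order. An
    ultrafilter extending a filter that meets all of them is in every [U]. *)
Lemma MA_baire_number :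
  MA infinite_subsets almost_subset continuum ->
  exists N : set (set omega_star),
    is_baire_number omega_star N /\ (continuum #<= N) && ~~ (N #<= continuum).
Proof.
move=> MAc; have [|N [Nod N0] Nmin] := @exists_least_card _
  [set F : set (set omega_star) |
    (forall D, F D -> open D /\ dense D) /\ \bigcap_(D in F) D = set0].
  exists [set ~` [set p] | p in setT]; split.
    by move=> _ [p _ <-]; exact: open_dense_omega_star_setC1.
  apply/seteqP; split=> // p pC.
  by apply: (pC (~` [set p])); first by exists p.
exists N; split; first by split=> //; exists N => //; exact: card_eqxx.
suff nNc : ~ (N #<= continuum).
  by apply/andP; split; [have [] := card_le_total continuum N|exact/negP].
move=> Nc.
have [U NU|G filG GN] := MA_indexed
    (E := fun U => [set A | infinite_set A /\ omega_star_basic A `<=` U]) MAc Nc.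
  have [openU denseU] := Nod U NU; split=> [A []//|X infX].
  have [q [Xq Uq]] := denseU _ (omega_star_basic_neq0 infX) (@open_omega_star_basic X).
  have [A Aq AU] := open_omega_starP openU Uq; have qU := omega_star_ultra q.
  exists (A `&` X); last by apply: sub_almost => n [].
  split; first exact: omega_star_infinite (filterI Aq Xq).
  move=> r AXr; apply: AU; apply: omega_star_almost AXr.
  by apply: sub_almost => n [].
have [p pG] := extend_to_omega_star filG.
suff : (\bigcap_(D in N) D) p by rewrite N0.
by move=> U /GN[g Gg [_]]; apply; exact: pG.
Qed.

(** * The hyperspace of a Psi-space: from MA to pseudocompactness *)

Section VietorisTopology.
Context (Y : topologicalType).
Implicit Types (C : hyperspace Y) (U V : set Y).

Lemma open_vietoris_subbase (O : set (hyperspace Y)) :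
  vietoris_subbase O -> open O.
Proof.
move=> subO; exists (set1 O); last by rewrite bigcup_set1.
by move=> _ ->; exact: (@finI_from1 _ _ _ id).
Qed.

Lemma open_vietoris_minus U : open U -> open (@vietoris_minus Y U).
Proof. by move=> openU; apply: open_vietoris_subbase; left; exists U. Qed.

Lemma open_vietoris_plus U : open U -> open (@vietoris_plus Y U).
Proof. by move=> openU; apply: open_vietoris_subbase; right; exists U. Qed.

Lemma vietoris_nbhs C (W : set (hyperspace Y)) : nbhs C W ->
  exists U (Vs : seq (set Y)), [/\ open U, \val C `<=` U,
    forall V, V \in Vs -> open V /\ \val C `&` V !=set0 &
    forall C' : hyperspace Y, \val C' `<=` U ->
      (forall V, V \in Vs -> \val C' `&` V !=set0) -> W C'].
Proof.
rewrite nbhsE => -[W' [[E EfinI <-] [B EB BC]] W'W].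
have [s0 [s0P s0B]] : exists s : seq (set (hyperspace Y)),
    (forall O', O' \in s -> vietoris_subbase O' /\ O' C) /\
    forall C' : hyperspace Y, (forall O', O' \in s -> O' C') ->
      (B : set (hyperspace Y)) C'.
  have [D' D'sub BE] := EfinI B EB; exists (finmap.enum_fset D').
  split=> [W1 W1D'|C' C'D']; last by rewrite -BE => W1 /C'D'.
  split; first by apply: set_mem; exact: D'sub.
  by move: BC; rewrite -BE; apply.
suff h (s : seq (set (hyperspace Y))) :
    (forall O', O' \in s -> vietoris_subbase O' /\ O' C) ->
    exists U (Vs : seq (set Y)), [/\ open U, \val C `<=` U,
    forall V, V \in Vs -> open V /\ \val C `&` V !=set0 &
    forall C' : hyperspace Y, \val C' `<=` U ->
      (forall V, V \in Vs -> \val C' `&` V !=set0) ->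
      forall O', O' \in s -> O' C'].
  have [U [Vs [oU CU VsP UVs]]] := h s0 s0P.
  exists U, Vs; split=> // C' C'U C'Vs; apply: W'W; exists B => //.
  by apply: s0B; exact: UVs C'U C'Vs.
elim: s => [|O' s IH] sP.
  by exists setT, [::]; split=> //; exact: openT.
have [|U [Vs [oU CU VsP UVs]]] := IH.
  by move=> O1 O1s; apply: sP; rewrite inE O1s orbT.
have [subO' O'C] := sP O' (mem_head _ _).
case: subO' O'C => -[V openV <-] O'C.
  exists U, (V :: Vs); split=> // [V'|C' C'U C'Vs O1].
    by rewrite inE => /orP[/eqP->|/VsP].
  rewrite inE => /orP[/eqP->|]; first by apply: C'Vs; exact: mem_head.
  by apply: UVs => // V' V'Vs; apply: C'Vs; rewrite inE V'Vs orbT.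
exists (U `&` V), Vs; split=> //; first exact: openI.
  by move=> x Cx; split; [exact: CU|exact: O'C].
move=> C' C'UV C'Vs O1; rewrite inE => /orP[/eqP->|O1s].
  by move=> x /C'UV[].
by apply: UVs O1s => // x /C'UV[].
Qed.

End VietorisTopology.

Section PsiSpace.
Context (A : set (set nat)).

Lemma open_PsiP (U : set (Psi A)) : open U <-> forall x, U x -> nbhs x U.
Proof. by rewrite openE; split. Qed.

Lemma open_Psi_basic a : open (Psi_basic a set0 : set (Psi A)).
Proof.
apply/open_PsiP => _ [->|[n [an _] <-]]; first by exists set0.
by right; exists n => //; split.
Qed.

Lemma closed_finite_inl (F : set nat) :
  finite_set F -> closed (inl @` F : set (Psi A)).
Proof.
move=> finF; rewrite -openC; apply/open_PsiP => -[n|a] nF //.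
by exists F => // _ [->|[n [_ nFn] <-] [m Fm [mn]]] //; apply: nFn; rewrite -mn.
Qed.

Lemma finite_hyper_subproof (F : set nat) : finite_set F -> F !=set0 ->
  exists C : hyperspace (Psi A), \val C = inl @` F.
Proof.
move=> finF [n Fn].
have CP : [set C : set (Psi A) | closed C /\ C !=set0] (inl @` F).
  by split; [exact: closed_finite_inl|exists (inl n), n].
by exists (SigSub (mem_set CP)).
Qed.

Hypothesis infA : A `<=` infinite_subsets.

Lemma open_Psi_inl (U : set (Psi A)) : open U -> U !=set0 ->
  exists n, U (inl n).
Proof.
move=> /open_PsiP openU [[n|a] Ux]; first by exists n.
have [F finF FU] := openU _ Ux.
have /infinite_setN0[n aFn] : infinite_set (\val a `\` F).
  by apply: infinite_setD finF; apply: infA; exact: set_valP.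
by exists n; apply: FU; right; exists n.
Qed.

(** Every nonempty open set of the Psi-space contains an integer: take one in [U] and one in [U]
    intersected with each [V]. *)
Lemma dense_finite_hyper (C : hyperspace (Psi A)) W : nbhs C W ->
  exists2 C', W C' & exists F, [/\ finite_set F, F !=set0 & \val C' = inl @` F].
Proof.
move=> /vietoris_nbhs[U [Vs [openU CU VsP UVs]]].
have [_ [x0 Cx0]] := set_valP C.
have [n0 Un0] := open_Psi_inl openU (ex_intro _ x0 (CU _ Cx0)).
have [s [sU sVs]] : exists s : seq nat, (forall n, n \in s -> U (inl n)) /\
    forall V, V \in Vs -> exists2 n, n \in s & V (inl n).
  elim: Vs VsP {UVs} => [|V Vs IH] VsP; first by exists [::].
  have [|s [sU sVs]] := IH; first by move=> V' V's; apply: VsP; rewrite inE V's orbT.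
  have [openV [x [Cx Vx]]] := VsP V (mem_head _ _).
  have [|n [Un Vn]] := open_Psi_inl (openI openU openV).
    by exists x; split=> //; exact: CU.
  exists (n :: s); split=> [m|V']; rewrite inE => /orP[/eqP->//|].
  - exact: sU.
  - by exists n => //; exact: mem_head.
  - by move=> /sVs[m ms V'm]; exists m => //; rewrite inE ms orbT.
have n0s : [set` n0 :: s] !=set0 by exists n0; exact: mem_head.
have finF : finite_set [set` n0 :: s] by apply/finite_seqP; exists (n0 :: s).
have [C' C'E] := finite_hyper_subproof finF n0s.
exists C'; last by exists [set` n0 :: s].
apply: UVs; rewrite C'E.
  by move=> _ [n /= + <-]; rewrite inE => /orP[/eqP->//|/sU].
move=> V /sVs[n ns Vn]; exists (inl n); split=> //; exists n => //=.
by rewrite inE ns orbT.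
Qed.

End PsiSpace.

Lemma finite_le_fibers (Z : set nat) (g : nat -> nat) m :
  (forall k, finite_set [set j | Z j /\ g j = k]) ->
  finite_set [set j | Z j /\ (g j <= m)%N].
Proof.
move=> gfib; elim: m => [|m IH].
  by apply: sub_finite_set (gfib 0%N) => j [Zj]; rewrite leqn0 => /eqP.
have : finite_set ([set j | Z j /\ (g j <= m)%N] `|` [set j | Z j /\ g j = m.+1]).
  by rewrite finite_setU.
apply: sub_finite_set => j [Zj]; rewrite leq_eqVlt => /orP[/eqP|].
  by right.
by rewrite ltnS; left.
Qed.

(** The sequence [g] along [J] is either constant or finite-to-one into a member [a]; it then
    converges to that integer or to the point [a]. *)
Definition converging (A : set (set nat)) (g : nat -> nat) (J : set nat) :=
  (exists k, forall j, J j -> g j = k) \/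
  (exists2 a, A a & (forall j, J j -> a (g j)) /\
     forall k, finite_set [set j | J j /\ g j = k]).

(** Either some fibre of [g] is infinite, or the image is infinite and some member of the maximal
    family meets it. *)
Lemma exists_converging (A : set (set nat)) (g : nat -> nat) (Z : set nat) :
  hits_all A -> infinite_set Z ->
  exists J, [/\ infinite_set J, J `<=` Z & converging A g J].
Proof.
move=> Ahit infZ.
have [[k Zk]|nk] := pselect (exists k, infinite_set [set j | Z j /\ g j = k]).
  exists [set j | Z j /\ g j = k]; split=> // [j []//|].
  by left; exists k => j [].
have gfib k : finite_set [set j | Z j /\ g j = k].
  by apply: contrapT => h; apply: nk; exists k.
have inf_gZ : infinite_set (g @` Z).
  apply/infinite_natP => m; apply: contrapT => nm; apply: infZ.
  apply: sub_finite_set (finite_le_fibers m gfib) => j Zj; split=> //.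
  rewrite leqNgt; apply/negP => mj; apply: nm; exists (g j); last exact: ltnW.
  by exists j.
have [a Aa agZ] := Ahit _ inf_gZ.
exists [set j | Z j /\ a (g j)]; split=> [finJ|j []//|].
  apply: agZ; apply: sub_finite_set (finite_image g finJ).
  by move=> k [ak [j Zj gj]]; exists j => //; split=> //; rewrite gj.
right; exists a => //; split=> [j []//|k].
by apply: sub_finite_set (gfib k) => j [[]].
Qed.

(** * Limits along an ultrafilter *)

Section SelectorLimits.
Context (A : set (set nat)) (p : omega_star).

Lemma converging_limit (g : nat -> nat) (J : set nat) :
  omega_star_basic J p -> converging A g J ->
  exists x : Psi A, forall V, nbhs x V -> omega_star_basic [set j | V (inl (g j))] p.
Proof.
move=> pJ [[k Jk]|[a Aa [Ja gfib]]].
  exists (inl k) => V Vk; apply: omega_star_almost pJ; apply: sub_almost => j Jj /=.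
  by rewrite Jk.
exists (inr (SigSub (mem_set Aa))) => V [F finF FV].
apply: omega_star_almost pJ.
have [m Fm] : exists m, forall k, F k -> (k <= m)%N.
  apply: contrapT => nm.
  suff : infinite_set F by [].
  apply/infinite_natP => m; apply: contrapT => nk; apply: nm; exists m => k Fk.
  by rewrite leqNgt; apply/negP => mk; apply: nk; exists k => //; exact: ltnW.
apply: sub_finite_set (finite_le_fibers m gfib) => j [Jj nVj]; split=> //.
apply: Fm; apply: contrapT => nF; apply: nVj; apply: FV; right; exists (g j) => //.
by split=> //; exact: Ja.
Qed.

Hypothesis plim : forall g : nat -> nat, exists x : Psi A,
  forall V, nbhs x V -> omega_star_basic [set j | V (inl (g j))] p.

Lemma hyper_limit (F : nat -> set nat) (c : nat -> hyperspace (Psi A)) :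
  (forall j, F j !=set0) -> (forall j, \val (c j) = inl @` F j) ->
  exists C : hyperspace (Psi A), forall W : set (hyperspace (Psi A)),
    nbhs C W -> omega_star_basic [set j | W (c j)] p.
Proof.
move=> F0 cF; have pU := omega_star_ultra p.
(* The candidate limit: the points each of whose neighbourhoods meets [F j] for [p]-almost all
   [j]. *)
pose L : set (Psi A) := [set x | forall V, nbhs x V ->
  omega_star_basic [set j | exists2 m, F j m & V (inl m)] p].
have Llim g x : (forall j, F j (g j)) ->
    (forall V, nbhs x V -> omega_star_basic [set j | V (inl (g j))] p) -> L x.
  move=> Fg gx V /gx; apply: omega_star_almost; apply: sub_almost => j Vj.
  by exists (g j).
have closedL : closed L.
  rewrite -openC; apply/open_PsiP => x nLx.
  have [V Vx nV] : exists2 V, nbhs x V &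
      ~ omega_star_basic [set j | exists2 m, F j m & V (inl m)] p.
    apply: contrapT => nV; apply: nLx => V Vx; apply: contrapT => npV.
    by apply: nV; exists V.
  by apply: filterS (nbhs_interior Vx) => y Vy Ly; apply: nV; exact: Ly.
have L0 : L !=set0.
  have [g Fg] := choice F0; have [x gx] := plim g.
  by exists x; exact: Llim gx.
pose C : hyperspace (Psi A) := SigSub (mem_set (conj closedL L0 :
  [set C : set (Psi A) | closed C /\ C !=set0] L)).
exists C => W /vietoris_nbhs[U [Vs [/open_PsiP openU LU VsP UVs]]].
(* Otherwise, for [p]-almost all [j], a selector can be chosen outside [U]; its limit lies in [L],
   hence in [U], a contradiction. *)
have pUj : omega_star_basic [set j | inl @` F j `<=` U] p.
  have [//|pN] := in_ultra_setVsetC [set j | inl @` F j `<=` U] pU.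
  have /choice[g gP] j : exists m, F j m /\
      (~ (inl @` F j `<=` U) -> ~ U (inl m)).
    have [sub|nsub] := pselect (inl @` F j `<=` U).
      by have [m Fm] := F0 j; exists m.
    apply: contrapT => nm; apply: nsub => _ [m Fm <-].
    by apply: contrapT => nU; apply: nm; exists m.
  have [x gx] := plim g.
  have Ux : U x by apply: LU; apply: Llim gx => j; have [] := gP j.
  exfalso; apply: (omega_star_disjoint (gx U (openU x Ux)) pN).
  by apply/seteqP; split=> // j [Uj nUj]; have [_ /(_ nUj)] := gP j.
have pVj : omega_star_basic
    [set j | forall V, V \in Vs -> (inl @` F j) `&` V !=set0] p.
  elim: Vs VsP {UVs} => [|V Vs IH] VsP.
    by apply: omega_star_almost (filterT : omega_star_basic setT p); exact: sub_almost.
  have [/open_PsiP openV [x [Lx Vx]]] := VsP V (mem_head _ _).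
  have pV := Lx V (openV x Vx).
  apply: filterS (filterI pV (IH _)) => [j [[m Fm Vm] h] V'|V' V's].
    rewrite inE => /orP[/eqP->|/h//].
    by exists (inl m); split=> //; exists m.
  by apply: VsP; rewrite inE V's orbT.
apply: filterS (filterI pUj pVj) => j [Uj Vj].
by apply: UVs; rewrite cF.
Qed.

End SelectorLimits.

Lemma MA_pseudocompact (R : realType) :
  MA infinite_subsets almost_subset continuum ->
  forall A, mad A -> pseudocompact R (hyperspace (Psi A)).
Proof.
move=> MAc A /madP[_ [Ainf _] Ahit] f fcont; apply: contrapT => nbound.
have big (n : nat) : exists C, (n%:R < `|f C|)%R.
  apply: contrapT => nC; apply: nbound; exists n%:R%R; split; first exact: num_real.
  move=> M nM C _; apply: le_trans (ltW nM); rewrite leNgt; apply/negP => h.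
  by apply: nC; exists C.
have near_f C : nbhs C [set C' | (`|f C - f C'| < 1)%R].
  by have /cvgr_dist_lt/(_ 1%R ltr01) := fcont C.
have /choice[cF cFP] (n : nat) : exists cF : hyperspace (Psi A) * set nat,
    [/\ (n%:R < `|f cF.1|)%R, cF.2 !=set0 & \val cF.1 = inl @` cF.2].
  (* One unit is reserved for the passage from [C] to a nearby finite set. *)
  have [C nC] := big n.+1.
  have [C' CC' [F [finF F0 C'F]]] := dense_finite_hyper Ainf (near_f C).
  exists (C', F); split=> //=; rewrite -natr1 in nC.
  have := ler_normD (f C - f C')%R (f C'); rewrite subrK => h.
  have : (`|f C - f C'| < 1)%R by [].
  by move: nC h; lra.
(* Sequences of integers are coded by subsets of omega through their graphs, so continuum many dense
   sets handle all of them. *)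
pose gx (x : set nat) (n : nat) : nat := xget 0%N [set m | x (pickle (n, m))].
have gxsurj g : exists x, gx x = g.
  exists [set pickle (n, g n) | n in setT]; apply/funext => n.
  apply: xget_unique; first by exists n.
  by move=> m [k _ /(pcan_inj pickleK) [-> ->]].
pose E x := [set J | infinite_set J /\ converging A (gx x) J].
have [|x _|G filG GE] := MA_indexed (A := setT) (E := E) MAc; first exact: card_lexx.
  split=> [J []//|Z infZ].
  have [J [infJ JZ Jconv]] := exists_converging (gx x) Ahit infZ.
  by exists J => //; exact: sub_almost.
have [p pG] := extend_to_omega_star filG.
have plim g : exists x : Psi A,
    forall V, nbhs x V -> omega_star_basic [set j | V (inl (g j))] p.
  have [x <-] := gxsurj g; have [J GJ [_ Jconv]] := GE x I.
  exact: converging_limit (pG J GJ) Jconv.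
have [C Cacc] := @hyper_limit A p plim (fun n => (cF n).2) (fun n => (cF n).1)
  (fun n => let: And3 _ h _ := cFP n in h) (fun n => let: And3 _ _ h := cFP n in h).
(* Infinitely many [c n] would have values within 1 of [f C], although these values exceed [n] in
   absolute value. *)
have /omega_star_infinite/infinite_natP := Cacc _ (near_f C).
have C1 : (0 <= `|f C| + 1)%R by rewrite addr_ge0// ler01.
move=> /(_ (Num.bound (`|f C| + 1)%R))[k /= fk lek].
have [kf _ _] := cFP k; have bk := archi_boundP C1.
have : ((Num.bound (`|f C| + 1))%:R <= k%:R :> R)%R by rewrite ler_nat.
have := ler_normD (f C - f (cF k).1)%R (- f C)%R; rewrite addrAC subrr add0r !normrN.
by move: fk kf bk; lra.
Qed.

(** * From pseudocompactness to MA *)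

Lemma filter_forall_lt (T : Type) (F : set_system T) (P : nat -> set T) n :
  Filter F -> (forall k, F (P k)) -> F [set x | forall k, (k < n)%N -> P k x].
Proof.
move=> FF FP; elim: n => [|n IH]; first by apply: filterS filterT.
apply: filterS (filterI IH (FP n)) => x [xlt Pn] k.
by rewrite ltnS leq_eqVlt => /orP[/eqP->//|/xlt].
Qed.

Section FiniteHyper.
Context (A : set (set nat)) (C : hyperspace (Psi A)) (F : set nat).
Hypotheses (finF : finite_set F) (CF : \val C = inl @` F).

(** The integers of [F] are isolated, so [C] is singled out by [F] as upper bound and by meeting
    each of its finitely many singletons. *)
Lemma nbhs_finite_hyper : nbhs C [set C].
Proof.
have openF : open (inl @` F : set (Psi A)).
  by apply/open_PsiP => _ [n Fn <-]; exists n.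
have openn n : open [set inl n : Psi A] by apply/open_PsiP => _ ->.
have nbF : nbhs C (vietoris_plus (inl @` F : set (Psi A))).
  apply: open_nbhs_nbhs; split; first exact: open_vietoris_plus.
  by rewrite /vietoris_plus /= CF.
have [m Fm] : exists m, forall k, F k -> (k < m)%N.
  apply: contrapT => nm; suff : infinite_set F by [].
  apply/infinite_natP => m; apply: contrapT => nk; apply: nm; exists m => k Fk.
  by rewrite ltnNge; apply/negP => mk; apply: nk; exists k.
have nbn k : nbhs C [set C' : hyperspace (Psi A) | F k -> \val C' (inl k)].
  have [Fk|nFk] := pselect (F k); last by apply: filterS filterT => C' _ /nFk.
  have : nbhs C (vietoris_minus [set inl k : Psi A]).
    apply: open_nbhs_nbhs; split; first exact: open_vietoris_minus.
    by exists (inl k); split=> //; rewrite CF; exists k.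
  by apply: filterS => C' [x [C'x xk]] _; rewrite -xk.
apply: filterS (filterI nbF (filter_forall_lt m _ nbn)) => C' [C'F FC'].
apply: val_inj; apply/seteqP; split=> x; first by rewrite CF; exact: C'F.
by rewrite CF => -[n Fn <-]; exact: (FC' n (Fm n Fn) Fn).
Qed.

Lemma nbhs_neq_finite_hyper (C' : hyperspace (Psi A)) :
  C' <> C -> nbhs C' (~` [set C]).
Proof.
move=> C'C.
have [[x C'x nFx]|C'F] := pselect (exists2 x, \val C' x & ~ (inl @` F) x).
  have : nbhs C' (vietoris_minus (~` (inl @` F : set (Psi A)))).
    apply: open_nbhs_nbhs; split; last by exists x.
    by apply: open_vietoris_minus; rewrite openC; exact: closed_finite_inl.
  by apply: filterS => _ /[swap] -> [y []]; rewrite CF.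
have [n Fn nC'n] : exists2 n, F n & ~ \val C' (inl n).
  apply: contrapT => nn; apply: C'C; apply: val_inj; rewrite CF.
  apply/seteqP; split=> [x C'x|_ [n Fn <-]]; apply: contrapT => nx.
    by apply: C'F; exists x.
  by apply: nn; exists n.
have : nbhs C' (vietoris_plus (~` (inl @` [set n] : set (Psi A)))).
  apply: open_nbhs_nbhs; split.
    apply: open_vietoris_plus; rewrite openC.
    exact: closed_finite_inl (finite_set1 n).
  by move=> x C'x [k -> nx]; apply: nC'n; rewrite nx.
apply: filterS => _ /[swap] -> /(_ (inl n)); apply; first by rewrite CF; exists n.
by exists n.
Qed.

End FiniteHyper.

(** Without accumulation point, the function equal to [n] at [c n] and to 0 elsewhere is locally
    constant, hence continuous, yet unbounded. *)
Lemma pseudocompact_accumulation (R : realType) (A : set (set nat))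
    (c : nat -> hyperspace (Psi A)) (F : nat -> set nat) :
  (forall n, finite_set (F n)) -> (forall n, \val (c n) = inl @` F n) ->
  injective c -> pseudocompact R (hyperspace (Psi A)) ->
  exists C : hyperspace (Psi A), forall W : set (hyperspace (Psi A)), nbhs C W ->
    infinite_set [set n | W (c n)].
Proof.
move=> finF cF cinj psc; apply: contrapT => nacc.
have /choice[f fP] C : exists r : R, (forall n, C = c n -> r = n%:R%R) /\
    ((forall n, C <> c n) -> r = 0%R).
  have [[n ->]|nn] := pselect (exists n, C = c n).
    exists n%:R%R; split=> [m /cinj -> //|/(_ n) //].
  exists 0%R; split=> // n Cn; by case: nn; exists n.
have fcst C : nbhs C [set C' | f C' = f C].
  have [[n ->]|nn] := pselect (exists n, C = c n).
    by apply: filterS (nbhs_finite_hyper (finF n) (cF n)) => _ ->.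
  have [W CW finW] : exists2 W : set (hyperspace (Psi A)), nbhs C W &
      finite_set [set n | W (c n)].
    apply: contrapT => nW; apply: nacc; exists C => W CW finW.
    by apply: nW; exists W.
  have [m Wm] : exists m, forall k, W (c k) -> (k < m)%N.
    apply: contrapT => nm; suff : infinite_set [set n | W (c n)] by [].
    apply/infinite_natP => m; apply: contrapT => nk; apply: nm; exists m => k Wk.
    by rewrite ltnNge; apply/negP => mk; apply: nk; exists k.
  have nbc n : nbhs C (~` [set c n]).
    by apply: (nbhs_neq_finite_hyper (finF n) (cF n)) => Cn; apply: nn; exists n.
  apply: filterS (filterI CW (filter_forall_lt m _ nbc)) => C' [WC' C'lt] /=.
  have [_ ->] := fP C; last by move=> n Cn; apply: nn; exists n.
  have [_ ->//] := fP C'; move=> n C'n.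
  by apply: (C'lt n) => //; apply: Wm; rewrite -C'n.
have fcont : continuous f.
  move=> C V /nbhs_singleton VfC; apply: filterS (fcst C) => C' /= ->.
  exact: VfC.
have [M [_ /(_ (`|M| + 1)%R)]] := psc f fcont.
have -> : (M < `|M| + 1)%R by have := ler_norm M; lra.
move=> /(_ isT) bound.
have [+ _] := fP (c (Num.bound (`|M| + 1)%R)) => /(_ _ erefl) fE.
have := bound (c (Num.bound (`|M| + 1)%R)) I; rewrite /= fE.
by rewrite ger0_norm ?ler0n// leNgt archi_boundP.
Qed.

Definition tree_level n := [set m : nat | (2 ^ n <= m < 2 ^ n.+1)%N].

Lemma finite_tree_level n : finite_set (tree_level n).
Proof. by apply: sub_finite_set (finite_II (2 ^ n.+1)) => m /= /andP[]. Qed.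

Lemma tree_level_bnode x n : tree_level n (bnode x n).
Proof. exact: bnode_bounds. Qed.

Lemma tree_level_inj m n k : tree_level m k -> tree_level n k -> m = n.
Proof.
move=> /andP[mlo mhi] /andP[nlo nhi].
apply/eqP; rewrite eqn_leq -ltnS -[(n <= m)%N]ltnS.
rewrite -(@ltn_exp2l 2)// -(@ltn_exp2l 2 n)//.
by rewrite (leq_ltn_trans mlo nhi) (leq_ltn_trans nlo mhi).
Qed.

(** On the branch [x] the MAD family contains copies of a maximal almost disjoint subfamily [M x] of
    the [x]-th dense set. An accumulation point [C] of the tree levels must contain one of these
    copies for each [x], and the index sets of the levels lying in neighbourhoods of [C] generate
    the filter. *)
Lemma pseudocompact_MA (R : realType) :
  (forall A, mad A -> pseudocompact R (hyperspace (Psi A))) ->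
  MA infinite_subsets almost_subset continuum.
Proof.
move=> psc F Fc Fd; have [d [dd dF]] := enumerate_dense setT Fc Fd.
pose D x := almost_closure (d x).
have Dod x : open_dense (D x) by exact: open_dense_closure.
have /choice[M MP] x : exists M, [/\ M `<=` D x, ad_family M & hits_all M].
  have [Dinf Dd _] := Dod x.
  have [||M [_ MD adM Mhit]] := @ad_extend (D x) set0 Dinf Dd; last by exists M.
    by [].
  by split=> [a []|a b []].
have Minf x B : M x B -> infinite_set B.
  by have [MD _ _] := MP x => /MD; have [Dinf _ _] := Dod x; exact: Dinf.
pose A0 := [set a | exists x, exists2 B, M x B & a = bnode x @` B].
have A0inf : A0 `<=` infinite_subsets.
  by move=> _ [x [B /Minf infB ->]]; apply: infinite_image infB; exact: bnode_inj.
have A0ad : ad_family A0.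
  split=> // _ _ [x [B xB ->]] [y [B' yB' ->]] BB'.
  have E : x = y.
    apply: branch_set_ad; apply: almost_meets BB';
      by apply: sub_almost => _ [n _ <-]; exists n.
  rewrite -E in yB' BB' *; have [_ [_ adM] _] := MP x.
  by rewrite (adM B B')//; apply: meets_image BB'; exact: bnode_inj.
have [//|X infX|||A [A0A Ainf adA Ahit]] := @ad_extend infinite_subsets A0.
  by exists X.
  by [].
  by [].
have madA : mad A.
  apply/madP; split=> //.
  have /choice[B BM] x : exists B, M x B.
    by have [_ _ /(_ _ infinite_nat)[B xB _]] := MP x; exists B.
  apply/infiniteP; apply: (@card_le_inj _ _ _ _ (fun n => bnode [set n] @` B [set n])).
    by move=> n _; apply: A0A; exists [set n], (B [set n]).
  move=> m n _ _ mn; have : [set m] = [set n].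
    apply: branch_set_ad.
    apply: (@common_meets (bnode [set m] @` B [set m])).
    - by apply: A0inf; exists [set m], (B [set m]).
    - by apply: sub_almost => _ [k _ <-]; exists k.
    - by rewrite mn; apply: sub_almost => _ [k _ <-]; exists k.
  by move=> /(congr1 (fun Z => Z m)) /= E; rewrite -E.
have /choice[c cE] n : exists C : hyperspace (Psi A), \val C = inl @` tree_level n.
  apply: finite_hyper_subproof; first exact: finite_tree_level.
  by exists (bnode set0 n); exact: tree_level_bnode.
have cinj : injective c.
  move=> m n mn; have : \val (c m) (inl (bnode set0 m)).
    by rewrite cE; exists (bnode set0 m) => //; exact: tree_level_bnode.
  rewrite mn cE => -[k nk [km]]; rewrite km in nk.
  exact: tree_level_inj (tree_level_bnode set0 m) nk.
have [C Cacc] := pseudocompact_accumulation finite_tree_level cE cinj (psc A madA).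
have pick x : exists2 B, M x B & exists2 a : set_type A,
    \val C (inr a) & \val a = bnode x @` B.
  apply: contrapT => nB.
  (* The branch together with all its copies is closed: a member having infinite intersection with
     the branch meets, by maximality of [M x], one of the copies, and so equals it. *)
  pose bad : set (Psi A) := (inl @` branch_set x) `|`
    [set inr a | a in [set a : set_type A | exists2 B, M x B & \val a = bnode x @` B]].
  have openU : open (~` bad).
    apply/open_PsiP => -[n|a] nbad //.
    exists (\val a `&` branch_set x); last first.
      move=> _ [->//|[n [an nan] <-]] [[k xk [kn]]|[b _]] //.
      by apply: nan; split=> //; rewrite -kn.
    apply: contrapT => infax; apply: nbad; right; exists a => //.
    have infN : infinite_set (bnode x @^-1` \val a).
      move=> finN; apply: infax; apply: sub_finite_set (finite_image (bnode x) finN).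
      by move=> k [ak [n _ nk]]; exists n => //=; rewrite nk.
    have [_ _ /(_ _ infN)[B xB BN]] := MP x; exists B => //.
    have [_ adA'] := adA; apply: adA' => //; first exact: set_valP.
      by apply: A0A; exists x, B.
    have : infinite_set (bnode x @` (B `&` bnode x @^-1` \val a)).
      by apply: infinite_image BN; exact: bnode_inj.
    by apply: sub_infinite_set => _ [n [Bn an] <-]; split=> //; exists n.
  (* No integer is in [C], since each lies on a single level; by assumption no copy is in [C]
     either. *)
  have CU : \val C `<=` ~` bad.
    move=> z Cx [[m xm mx]|[a [B xB aB] ax]]; last first.
      by apply: nB; exists B => //; exists a => //; rewrite ax.
    have openm : open [set inl m : Psi A] by apply/open_PsiP => _ ->.
    have /Cacc/infinite_natP infm : nbhs C (vietoris_minus [set inl m : Psi A]).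
      apply: open_nbhs_nbhs; split; first exact: open_vietoris_minus.
      by exists (inl m); split=> //; rewrite mx.
    have lev n : (vietoris_minus [set inl m : Psi A]) (c n) -> tree_level n m.
      by rewrite /vietoris_minus /= cE => -[_ [[k nk <-] [<-]]].
    have [n0 /lev n0m _] := infm 0%N; have [n1 /lev n1m] := infm n0.+1.
    by rewrite (tree_level_inj n0m n1m) ltnn.
  (* So some level would avoid the branch, although every level contains a node of it. *)
  have /Cacc/infinite_setN0[n] : nbhs C (vietoris_plus (~` bad)).
    by apply: open_nbhs_nbhs; split=> //; exact: open_vietoris_plus.
  rewrite /= /vietoris_plus /= cE => /(_ (inl (bnode x n))) h.
  apply: h; first by exists (bnode x n) => //; exact: tree_level_bnode.
  by left; exists (bnode x n) => //; exists n.
exists [set Y | infinite_set Y /\ exists2 W : set (hyperspace (Psi A)),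
    nbhs C W & almost_subset [set n | W (c n)] Y].
  split.
  - by move=> Y [].
  - exists setT; split; first exact: infinite_nat.
    by exists setT; [exact: filterT|exact: sub_almost].
  - move=> Y Z [_ [W CW WY]] infZ YZ; split=> //; exists W => //.
    exact: almost_trans YZ.
  - move=> Y Z [_ [W CW WY]] [_ [W' CW' WZ]].
    exists [set n | (W `&` W') (c n)]; split.
    + split; first by apply: Cacc; exact: filterI.
      by exists (W `&` W'); [exact: filterI|exact: almost_refl].
    + by apply: almost_trans WY; apply: sub_almost => n [].
    + by apply: almost_trans WZ; apply: sub_almost => n [].
move=> E FE; have [x dx] := dF E FE; have [B xB [a Ca aB]] := pick x.
have [MD _ _] := MP x; have [infB [g dg Bg]] := MD B xB; rewrite dx in dg.
exists g; split=> //; split; first by have [Einf _] := Fd E FE; exact: Einf.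
(* A level meeting [a] has its index in [B], because the node of index [k] on a branch lies on level
   [k]. *)
exists (vietoris_minus (Psi_basic a set0)).
  apply: open_nbhs_nbhs; split.
    exact/open_vietoris_minus/open_Psi_basic.
  by exists (inr a); split=> //; left.
apply: almost_trans Bg; apply: sub_almost => n.
rewrite /= /vietoris_minus /= cE => -[_ [[m nm <-] [//|[j [aj _] [jm]]]]].
rewrite aB in aj; case: aj => k Bk kj; rewrite -jm -kj in nm.
by rewrite -(tree_level_inj (tree_level_bnode x k) nm).
Qed.

Theorem theorem2p4 (R : realType) :
  [<->
    MA infinite_subsets almost_subset continuum;

    forall A : set (set nat), mad A -> pseudocompact R (hyperspace (Psi A));

    is_distributivity_number continuum /\
    forall (K : Type) (Q : rel K), is_distributivity_ordinal Q ->
      forall S : set (set nat), base_tree Q S ->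
        exists B : set (set nat), cofinal_branch Q S B;

    exists N : set (set omega_star),
      is_baire_number omega_star N /\ (continuum #<= N) && ~~ (N #<= continuum)].
Proof.
(* The cycle runs (a), (b), (c), (d), (a); the implications out of (b) and (c) pass through (a). *)
tfae.
- exact: MA_pseudocompact.
- move=> /pseudocompact_MA MAc.
  by split; [exact: MA_distributivity_number|exact: MA_cofinal_branch].
- by move=> [hc trees]; apply: MA_baire_number; exact: cofinal_branch_MA.
- by move=> [N [baireN /andP[_ nNc]]]; exact: baire_number_MA baireN nNc.
Qed.
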